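(* Fix an integer $d\ge 2$ and let $k=k(p)$, $1\le k\le p$, be integers with $k=o(p)$ as $p\to\infty$. Let $\tilde{\mathrm P}_p$ be either the Bernoulli prior (for all $p$) or the Bernoulli-Rademacher prior (for all $p$) on $\mathbb R^p$. For fixed $\beta\ge 0$, consider the sparse tensor PCA model $$\mathbf Y=\beta\sqrt{2k\log\left(\frac pk\right)}\;\mathbf x^{\otimes d}+\mathbf Z,\qquad \mathbf x\sim\tilde{\mathrm P}_p ,$$ where $\mathbf Z\in\mathbb R^{N}$, $N=p^d$, has i.i.d. standard Gaussian entries and is independent of $\mathbf x$. Then the model exhibits the all-or-nothing phenomenon: $$\lim_{N\to\infty}\mathbb E\left\|\mathbf x^{\otimes d}-\mathbb E[\mathbf x^{\otimes d}\mid\mathbf Y]\right\|^2=\begin{cases}1&\text{if }\beta<1,\\ 0&\text{if }\beta>1,\end{cases}$$ where $N=p^d$ and the limit is taken along $p\to\infty$.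
   Context: For $\mathbf x\in\mathbb R^p$, $\mathbf x^{\otimes d}\in\mathbb R^{p^d}$ denotes the vector whose entry indexed by $(i_1,\dots,i_d)\in\{1,\dots,p\}^d$ is $\mathbf x_{i_1}\cdots\mathbf x_{i_d}$; $\|\cdot\|$ is the Euclidean norm. Bernoulli prior: $\tilde{\mathrm P}_p$ is the uniform distribution over the vectors in $\{0,1/\sqrt k\}^p$ with exactly $k$ nonzero entries. Bernoulli-Rademacher prior: $\tilde{\mathrm P}_p$ is the uniform distribution over the vectors in $\{-1/\sqrt k,0,1/\sqrt k\}^p$ with exactly $k$ nonzero entries. *)

(* Defs.v *)
From HB Require Import structures.
From mathcomp Require Import all_boot all_order all_algebra.
From mathcomp Require Import finmap.
From mathcomp Require Import all_classical all_reals all_analysis.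
Import Order.TTheory GRing.Theory Num.Theory numFieldNormedType.Exports.

Set Implicit Arguments.
Unset Strict Implicit.
Unset Printing Implicit Defensive.

Local Open Scope fset_scope.
Local Open Scope classical_set_scope.
Local Open Scope ring_scope.

(* Euclidean norm. The library norm on matrices and finite products is the
   sup norm, hence this definition. *)
Definition enorm (R : realType) (I : finType) (u : I -> R) : R :=
  Num.sqrt (\sum_i u i ^+ 2).

(* Multi-indices (i_1, ..., i_d): there are p ^ d of them. *)
Definition tindex (d p : nat) : finType := {ffun 'I_d -> 'I_p}.

Definition tensor_pow (R : realType) (d p : nat) (x : 'rV[R]_p)
    (i : tindex d p) : R :=
  \prod_(l < d) x 0 (i l).

Inductive prior := Bernoulli | BernoulliRademacher.

Definition prior_values (R : realType) (pr : prior) (k : nat) : seq R :=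
  match pr with
  | Bernoulli => [:: 0; 1 / Num.sqrt k%:R]
  | BernoulliRademacher => [:: - (1 / Num.sqrt k%:R); 0; 1 / Num.sqrt k%:R]
  end.

Definition prior_support (R : realType) (pr : prior) (p k : nat) :
    set 'rV[R]_p :=
  [set v | (forall j, v 0 j \in prior_values R pr k) /\
           #|[pred j | v 0 j != 0]| = k].
Arguments prior_support R pr p k : clear implicits.

Section random_variables.
Context {d : measure_display} {T : measurableType d} {R : realType}.
Variable P : probability T R.

(* Probability mass function of the uniform law on S, meaningful only for S
   finite and nonempty: fset_set S is empty when S is infinite. *)
Definition uniform_on (V : choiceType) (S : set V) (x : T -> V) : Prop :=
  forall v, P (x @^-1` [set v]) =
    (if v \in S then (#|` fset_set S |%:R)^-1 else 0)%:E.

Definition standard_gaussian (X : {RV P >-> R}) : Prop :=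
  forall B, measurable B -> distribution P X B = normal_prob 0 1 B.

Definition sigma_gen (I : Type) (X : I -> T -> R) : set (set T) :=
  <<s \bigcup_i preimage_set_system setT (X i) measurable >>.

Definition mutually_independent (I : finType) (X : I -> T -> R) : Prop :=
  forall (J : {set I}) (B : I -> set R), (forall i, measurable (B i)) ->
    P (\bigcap_(i in [set` J]) (X i @^-1` B i)) =
    (\prod_(i in J) P (X i @^-1` B i))%E.

Definition independent (F G : set (set T)) : Prop :=
  forall A B, F A -> G B -> P (A `&` B) = (P A * P B)%E.

(* C is a version of the conditional expectation of X given the
   sigma-algebra G. *)
Definition is_cond_expectation (G : set (set T)) (X C : T -> R) : Prop :=
  [/\ preimage_set_system setT C measurable `<=` G,
      P.-integrable setT (EFin \o C) &
      forall A, G A -> (\int[P]_(w in A) (C w)%:E = \int[P]_(w in A) (X w)%:E)%E].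

Definition rvec (p : nat) (x : 'I_p -> T -> R) (w : T) : 'rV[R]_p :=
  \row_j x j w.

(* The observation Y, entry by entry. *)
Definition tensor_pca (beta : R) (n p k : nat) (x : 'I_p -> T -> R)
    (Z : tindex n p -> T -> R) (i : tindex n p) (w : T) : R :=
  beta * Num.sqrt (2 * k%:R * ln (p%:R / k%:R)) * tensor_pow (rvec x w) i
  + Z i w.

End random_variables.

(* Main.v *)
From HB Require Import structures.
Require Import Defs.
From mathcomp Require Import all_boot all_order all_algebra.
From mathcomp Require Import finmap.
From mathcomp Require Import all_classical all_reals all_analysis.
From mathcomp Require Import measurable_realfun.
From mathcomp Require Import ring lra.
Import Order.TTheory GRing.Theory Num.Theory numFieldNormedType.Exports.

(** Write [L = 2 k ln (p / k)], [s = beta sqrt L], let [X_v], for [v] in the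
    support of the prior, be the possible (unit) signals, [M] their number and
    [rho u v = <X_u, X_v>].  The posterior weights are proportional to
    [w_v(y) = exp (s <X_v, y> - s^2 / 2)], and the conditional expectation is
    the weighted average of the [X_v].  By Cameron-Martin, averaging a function
    of the observation when the signal is [X_v] amounts to averaging it,
    multiplied by [w_v], under pure noise; hence the mean square error is the
    pure noise mean of

      (1 / (M D)) sum_(u, v) w_u w_v (1 - rho u v),    D = sum_v w_v,

    and one minus the error is the same expression with [rho] instead of
    [1 - rho] (the pure noise mean of [D / M] is 1).

    A first moment computation of these sums fails, being dominated by rare
    events.  Under the posterior, however, [<X_v, y>] is close to [s] for both
    the signal and a sample from the posterior, and once all pairs of weights
    are restricted to this typical event first moments suffice.  The
    restriction is never made by indicators: it is replaced by exponential
    (Chernoff) factors of linear forms in [y], so that every mean to be computed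
    is that of the exponential of a linear form.
      - For [beta < 1] the pairs with [rho > eps] are negligible.  Either
        [D <= tau M], which costs at most [tau], or [D] may be replaced by
        [tau M], and a typical pair contributes
        [exp (s^2 rho / (1 + rho))] (near_pointwise, mse_density_near).
      - For [beta > 1] the pairs with [rho < 1 - eps] are negligible.  Here [D]
        is bounded below by one of the weights, and a typical pair contributes
        [exp (- s^2 (1 - rho) / (2 (1 + rho)))] (far_pointwise,
        mse_density_far).

    It remains to weigh these against the number of pairs.  If the supports of
    [u] and [v] share a fraction [t] of their elements, then
    [rho <= t ^ d <= t ^ 2], and a proportion about [(k / p) ^ (t k)] =
    [exp (- L t / 2)] of the support of the prior shares that much with [u]
    (sum_code_le), while [M] is about [exp (L / 2)] (card_code_le).  Both regimes
    then rest on elementary inequalities, and this is where [d >= 2] enters: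
    [2 t ^ 2 / (1 + t ^ 2) <= t] and [(1 - t ^ 2) / (1 + t ^ 2) >= 1 - t].  The
    factors [beta ^ 2] on either side of 1 turn them into exponential gains
    [exp (- c L)] (near_exponent, far_exponent), and these absorb the entropy
    corrections [exp (O(k))] since [L / k] tends to infinity with [p / k]. *)

Set Implicit Arguments.
Unset Strict Implicit.
Unset Printing Implicit Defensive.

Local Open Scope classical_set_scope.
Local Open Scope ring_scope.

(** * Measures with a density, and translated Gaussian laws *)

Section mdensity.
Context d (T : measurableType d) (R : realType).
Variables (mu : {measure set T -> \bar R}) (W : {mfun T >-> R}).
Hypothesis W0 : forall x, 0 <= W x.
Local Open Scope ereal_scope.

(** The nonnegativity proof is an argument, so that the measure instance can
    be inferred from the term. *)
Definition mdensity of (forall x, (0 <= W x)%R) :=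
  fun A => \int[mu]_(x in A) (W x)%:E.

Local Notation nu := (mdensity W0).

Let nu0 : nu set0 = 0.
Proof. by rewrite /mdensity integral_set0. Qed.

Let nu_ge0 A : 0 <= nu A.
Proof. by apply: integral_ge0 => x _; rewrite lee_fin. Qed.

Let nu_sigma_additive : semi_sigma_additive nu.
Proof.
move=> F mF tF mUF; rewrite /mdensity ge0_integral_bigcup//=.
- by apply: is_cvg_ereal_nneg_natsum => n _; exact: nu_ge0.
- by apply/measurable_EFinP; exact: measurable_funTS.
- by move=> x _; rewrite lee_fin.
Qed.

HB.instance Definition _ :=
  isMeasure.Build _ _ _ nu nu0 nu_ge0 nu_sigma_additive.

Import HBNNSimple.

Let integral_mdensity_nnsfun (h : {nnsfun T >-> R}) :
  \int[nu]_x (h x)%:E = \int[mu]_x ((W x)%:E * (h x)%:E).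
Proof.
under [LHS]eq_integral do rewrite fimfunE -fsumEFin//.
rewrite [LHS]ge0_integral_fsum//; last 2 first.
  - by move=> r; exact/measurable_EFinP/measurableT_comp.
  - by move=> n x _; rewrite EFinM nnfun_muleindic_ge0.
under [RHS]eq_integral.
  move=> x xD; rewrite fimfunE -fsumEFin// ge0_mule_fsumr; last first.
    by move=> r; rewrite EFinM nnfun_muleindic_ge0.
  over.
rewrite [RHS]ge0_integral_fsum//; last 2 first.
  - move=> r; apply: emeasurable_funM; first exact/measurable_EFinP.
    by apply/measurable_EFinP; do 2 apply/measurableT_comp => //.
  - by move=> n x _; rewrite mule_ge0 ?lee_fin ?W0// -lee_fin EFinM
      nnfun_muleindic_ge0.
apply: eq_fsbigr => r; rewrite inE => -[x0 _ <-].
under [RHS]eq_integral do rewrite EFinM muleCA.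
rewrite [RHS]ge0_integralZl//; last 3 first.
- apply: emeasurable_funM; first exact/measurable_EFinP.
  by apply/measurable_EFinP.
- by move=> t _; rewrite mule_ge0 ?lee_fin.
- by rewrite lee_fin.
rewrite integralZl_indic_nnsfun// integral_indic// setIT; congr (_ * _).
rewrite /mdensity (eq_integral ((fun x => (W x)%:E) \_ (h @^-1` [set h x0])))//.
  by rewrite -integral_mkcond.
move=> t _; rewrite patchE indicE; case: ifP => _; rewrite ?mule1 ?mule0//.
Qed.

Lemma ge0_integral_mdensity (f : T -> \bar R) :
  measurable_fun setT f -> (forall x, 0 <= f x) ->
  \int[nu]_x f x = \int[mu]_x ((W x)%:E * f x).
Proof.
move=> mf f0; pose f_ := nnsfun_approx measurableT mf.
transitivity (limn (fun n => \int[nu]_x (f_ n x)%:E)).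
  rewrite -monotone_convergence//=.
  - apply: eq_integral => x _; apply/esym/cvg_lim => //=.
    exact: cvg_nnsfun_approx.
  - by move=> n; apply: measurableT_comp => //; exact: measurable_funTS.
  - by move=> n x _; rewrite lee_fin.
  - by move=> x _ a b ab; rewrite lee_fin//; exact/lefP/nd_nnsfun_approx.
under eq_fun do rewrite integral_mdensity_nnsfun.
rewrite -monotone_convergence//=.
- apply: eq_integral => x _; apply/cvg_lim => //=.
  by apply: cvgeZl => //; exact: cvg_nnsfun_approx.
- move=> n; apply: emeasurable_funM; first exact/measurable_EFinP.
  by apply: measurableT_comp => //; exact: measurable_funTS.
- by move=> n x _; rewrite mule_ge0 ?lee_fin.
- move=> x _ a b ab; rewrite lee_wpmul2l ?lee_fin//.
  exact/lefP/nd_nnsfun_approx.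
Qed.

End mdensity.

Section push_density.
Context d d' (T : measurableType d) (E : measurableType d') (R : realType).
Local Open Scope ereal_scope.

(** A change of measure that only has to be checked on sets. *)
Lemma ge0_integral_pushdensity (mu : {measure set T -> \bar R})
    (nu : {measure set E -> \bar R}) (phi : T -> E) (W : T -> R)
    (f : E -> \bar R) :
  measurable_fun setT phi -> measurable_fun setT W -> (forall x, 0 <= W x)%R ->
  (forall B, measurable B -> \int[mu]_(x in phi @^-1` B) (W x)%:E = nu B) ->
  measurable_fun setT f -> (forall x, 0 <= f x) ->
  \int[mu]_x ((W x)%:E * f (phi x)) = \int[nu]_y f y.
Proof.
move=> mphi mW W0 H mf f0.
pose V : {mfun T >-> R} := HB.pack W (isMeasurableFun.Build _ _ _ _ _ mW).
have V0 : forall x, (0 <= V x)%R := W0.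
rewrite -(ge0_integral_mdensity mu V0); last 2 first.
- exact: measurableT_comp.
- by move=> x.
have /= := @ge0_integral_pushforward _ _ _ _ _ _ mphi (mdensity mu V0) setT f
  measurableT mf (fun y _ => f0 y).
rewrite preimage_setT => <-.
apply: eq_measure_integral => B mB _.
by rewrite /pushforward/= /mdensity -H.
Qed.

(** The product formula for an integrand [W] independent of [phi], where
    independence is only required against events of the form [phi \in B]. *)
Lemma ge0_integral_indep (mu : {measure set T -> \bar R}) (phi : T -> E)
    (W : T -> R) (c : R) (f : E -> \bar R) :
  measurable_fun setT phi -> measurable_fun setT W -> (forall x, 0 <= W x)%R ->
  (0 <= c)%R ->
  (forall B, measurable B ->
    \int[mu]_(x in phi @^-1` B) (W x)%:E = c%:E * mu (phi @^-1` B)) ->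
  measurable_fun setT f -> (forall x, 0 <= f x) ->
  \int[mu]_x ((W x)%:E * f (phi x)) = c%:E * \int[mu]_x f (phi x).
Proof.
move=> mphi mW W0 c0 H mf f0.
pose phi' : {mfun T >-> E} := HB.pack phi (isMeasurableFun.Build _ _ _ _ _ mphi).
pose k : {nonneg R} := NngNum c0.
rewrite (@ge0_integral_pushdensity mu (mscale k (pushforward mu phi')))//.
rewrite ge0_integral_mscale//; congr (_ * _).
by rewrite ge0_integral_pushforward.
Qed.

End push_density.

Section gaussian_shift.
Context (R : realType).
Local Open Scope ereal_scope.
Notation mu := (@lebesgue_measure R).

Lemma ge0_integral_shift (f : R -> \bar R) (a : R) :
  measurable_fun [set: R] f -> (forall x, 0 <= f x) ->
  \int[mu]_x f (x + a)%R = \int[mu]_x f x.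
Proof.
move=> mf f0.
have mphi : measurable_fun [set: measurableTypeR R]
    (fun x : measurableTypeR R => (x + a)%R : measurableTypeR R).
  exact: measurable_funD.
have /= := @ge0_integral_pushforward _ _ _ _ _ _ mphi mu setT f
  measurableT mf (fun y _ => f0 y).
rewrite preimage_setT => <-.
apply: eq_measure_integral => A mA _; apply/esym.
apply: (@lebesgue_measure_unique R (pushforward mu _)) => // _ [[u v]] _ <-.
rewrite /pushforward/=.
rewrite [RHS](_ : _ = mu `](u - a)%R, (v - a)%R]%classic); last first.
  by congr (mu _); apply/seteqP; split => x /=; rewrite !in_itv/= ltrBlDr lerBrDr.
rewrite !lebesgue_measure_itv/= !lte_fin ltrD2r.
by case: ifP => // _; rewrite -!EFinB opprD addrACA subrr addr0.
Qed.

Lemma ge0_integral_normal_prob (f : R -> \bar R) :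
  measurable_fun [set: R] f -> (forall x, 0 <= f x) ->
  \int[normal_prob 0 1]_x f x = \int[mu]_x ((normal_pdf 0 1 x)%:E * f x).
Proof.
move=> mf f0; apply/esym.
apply: (@ge0_integral_pushdensity _ _ _ _ _ mu (normal_prob 0 1) id) => //.
- exact: measurable_normal_pdf.
- exact: normal_pdf_ge0.
Qed.

(** One-dimensional Cameron-Martin: the factor [exp (a x - a^2 / 2)] is the
    ratio of the densities of N(a, 1) and N(0, 1). *)
Lemma normal_prob_tilt (f : R -> \bar R) (a : R) :
  measurable_fun [set: R] f -> (forall x, 0 <= f x) ->
  \int[normal_prob 0 1]_x ((expR (a * x - a ^+ 2 / 2))%:E * f x) =
  \int[normal_prob 0 1]_x f (x + a)%R.
Proof.
move=> mf f0.
have mfa : measurable_fun [set: R] (fun x => f (x + a)%R).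
  by apply: measurableT_comp => //; exact: measurable_funD.
have me : measurable_fun [set: R] (fun x => (expR (a * x - a ^+ 2 / 2))%:E).
  apply/measurable_EFinP; apply: measurableT_comp => //.
  by apply: measurable_funB => //; exact: measurable_funM.
rewrite !ge0_integral_normal_prob//; last 2 first.
- exact: emeasurable_funM.
- by move=> x; rewrite mule_ge0 ?lee_fin ?expR_ge0.
rewrite -[LHS](@ge0_integral_shift _ a); last 2 first.
- apply: emeasurable_funM; last exact: emeasurable_funM.
  by apply/measurable_EFinP; exact: measurable_normal_pdf.
- by move=> x; rewrite !mule_ge0 ?lee_fin ?expR_ge0 ?normal_pdf_ge0.
apply: eq_integral => x _; rewrite muleA; congr (_ * _).
rewrite -EFinM; congr (_%:E).
rewrite !normal_pdfE ?oner_neq0// -mulrA -expRD; congr (_ * expR _)%R.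
rewrite expr1n.
by field.
Qed.

End gaussian_shift.

(** * The Cameron-Martin formula for i.i.d. standard Gaussian variables *)

(** Generators of the product sigma-algebra on [I -> R], the sigma-algebra for
    which a family of random variables is one measurable function. *)
Definition coord_sets (R : realType) (I : Type) : set (set (I -> R)) :=
  \bigcup_i preimage_set_system setT (fun y : I -> R => y i) measurable.
Arguments coord_sets : clear implicits.

Notation rspace R I := (g_sigma_algebraType (coord_sets R I)).

Section rspace_measurability.
Context (R : realType) (I : finType).

Lemma measurable_coord i : measurable_fun setT (fun y : rspace R I => y i).
Proof.
move=> _ B mB; rewrite setTI; apply: sub_sigma_algebra.
by exists i => //; exists B => //; rewrite setTI.
Qed.

Lemma measurable_fun_rspace d (T : measurableType d) (f : T -> rspace R I) :
  (forall i, measurable_fun setT (fun w => f w i)) -> measurable_fun setT f.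
Proof.
move=> mf; apply: (@measurability _ _ T (rspace R I) setT f (coord_sets R I))
    => //.
move=> _ [_ [i _ [B mB <-]] <-].
by rewrite !setTI; have := mf i measurableT B mB; rewrite setTI.
Qed.

Lemma measurable_preimage_rspace d (T : measurableType d) (X : I -> T -> R) :
  preimage_set_system setT ((fun w i => X i w) : T -> rspace R I) measurable =
  sigma_gen X.
Proof.
rewrite /sigma_gen -[LHS]g_sigma_preimageE; congr (<<s _ >>).
apply/seteqP; split => A.
- move=> [_ [i _ [B mB <-]] <-]; exists i => //; exists B => //; rewrite
    !setTI //.
- move=> [i _ [B mB <-]]; exists ((fun y => y i) @^-1` B).
  by exists i => //; exists B => //; rewrite setTI.
  by rewrite !setTI.
Qed.

Definition rects : set (set (rspace R I)) :=
  [set A | exists2 B : I -> set R, (forall i, measurable (B i)) &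
             A = [set y | forall i, B i (y i)]].

Lemma measurable_rect (B : I -> set R) : (forall i, measurable (B i)) ->
  measurable ([set y | forall i, B i (y i)] : set (rspace R I)).
Proof.
move=> mB.
rewrite (_ : [set y | _] = \bigcap_(i in [set: I]) [set y : rspace R I | B i
    (y i)]).
  apply: fin_bigcap_measurable => // i _.
  by have := measurable_coord i measurableT (mB i); rewrite setTI.
by apply/seteqP; split => y /= h i => [_|]; exact: h.
Qed.

Lemma rectsE : @measurable _ (rspace R I) = <<s rects >>.
Proof.
apply/seteqP; split; last first.
  apply: smallest_sub; first exact: sigma_algebra_measurable.
  by move=> _ [B mB ->]; exact: measurable_rect.
apply: smallest_sub; first exact: smallest_sigma_algebra.
move=> _ [i _ [B mB <-]]; rewrite setTI; apply: sub_sigma_algebra.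
exists (fun j => if j == i then B else setT).
  by move=> j; case: ifP.
apply/seteqP; split => y /=.
  by move=> By j; case: eqP => // ->.
by move=> /(_ i); rewrite eqxx.
Qed.

Lemma setI_closed_rects : setI_closed rects.
Proof.
move=> _ _ [B mB ->] [C mC ->]; exists (fun i => B i `&` C i).
  by move=> i; exact: measurableI.
apply/seteqP; split => y /=; first by move=> [h1 h2] i; split.
by move=> h; split => i; have [] := h i.
Qed.

(** Finite measures on the product space are determined by boxes, which form a
    pi-system generating the sigma-algebra. *)
Lemma rspace_measure_unique (m1 m2 : {measure set (rspace R I) -> \bar R}) :
  (m1 setT < +oo)%E ->
  (forall B : I -> set R, (forall i, measurable (B i)) ->
     m1 [set y | forall i, B i (y i)] = m2 [set y | forall i, B i (y i)]) ->
  forall A, measurable A -> m1 A = m2 A.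
Proof.
move=> m1oo H; apply: (measure_unique rects (fun=> setT)).
- exact: rectsE.
- exact: setI_closed_rects.
- by move=> _; exists (fun=> setT) => //; apply/seteqP; split.
- by apply/seteqP; split => // y _; exists 0%N.
- by move=> _ [B mB ->]; exact: H.
- by [].
Qed.

End rspace_measurability.

Section cameron_martin.
Context d (T : measurableType d) (R : realType) (P : probability T R).
Context (I : finType) (Z : I -> {RV P >-> R}).
Hypothesis Zgauss : forall i, standard_gaussian (Z i).
Hypothesis Zind : mutually_independent P Z.
Local Open Scope ereal_scope.

Let noise : T -> rspace R I := fun w i => Z i w.

Let measurable_noise : measurable_fun setT noise.
Proof. by apply: measurable_fun_rspace => i; exact: measurable_funP. Qed.

Let Zdist i B : measurable B -> P (Z i @^-1` B) = normal_prob 0 1 B.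
Proof. exact: Zgauss. Qed.

Lemma integral_gauss_comp i (f : R -> \bar R) :
  measurable_fun setT f -> (forall z, 0 <= f z) ->
  \int[P]_w f (Z i w) = \int[normal_prob 0 1]_z f z.
Proof.
move=> mf f0.
rewrite -(@ge0_integral_pushdensity _ _ _ _ _ P (normal_prob 0 1) (Z i) (cst
    1%R) f)//.
- by apply: eq_integral => w _; rewrite mul1e.
- exact: (measurable_funP (Z i)).
- move=> B mB; rewrite (eq_integral (cst 1))// integral_cst ?mul1e; first
    exact: Zdist.
  by have := measurable_funP (Z i) measurableT _ mB; rewrite setTI.
Qed.

(** The density of the shift by [a] of the coordinates in [J] only: the formula
    for all coordinates is reached by adding them to [J] one at a time. *)
Definition tilt (a : I -> R) (J : {set I}) (y : rspace R I) : R :=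
  \prod_i (if i \in J then expR (a i * y i - a i ^+ 2 / 2) else 1%R).

Lemma tilt_ge0 a J y : (0 <= tilt a J y)%R.
Proof. by apply: prodr_ge0 => i _; case: ifP => // _; exact: expR_ge0. Qed.

Lemma measurable_tilt a J : measurable_fun setT (tilt a J).
Proof.
apply: measurable_prod => i _; case: (i \in J) => //.
apply: measurableT_comp => //; apply: measurable_funB => //.
by apply: measurable_funM => //; exact: measurable_coord.
Qed.

Lemma tiltD1 a (J : {set I}) j y : j \in J ->
  tilt a J y = (expR (a j * y j - a j ^+ 2 / 2) * tilt a (J :\ j) y)%R.
Proof.
move=> jJ; rewrite /tilt (bigD1 j)//= jJ; congr (_ * _)%R.
rewrite [RHS](bigD1 j)//= !inE eqxx/= mul1r.
by apply: eq_bigr => i ij; rewrite !inE ij.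
Qed.

Lemma measurable_shift (B : set R) (b : R) :
  measurable B -> measurable [set z | B (z + b)%R].
Proof.
move=> mB; have mi : measurable_fun setT (fun z : R => (z + b)%R).
  exact: measurable_funD.
by have := mi measurableT _ mB; rewrite setTI.
Qed.

(** Induction on [J]: given the formula for [J :\ j] and all boxes, the
    variable [Z j] is independent of the rest of the integrand by
    ge0_integral_indep, and its own factor is handled by normal_prob_tilt. *)
Lemma integral_tilt_rect (a : I -> R) (J : {set I}) (B : I -> set R) :
  (forall i, measurable (B i)) ->
  \int[P]_(w in noise @^-1` [set y | forall i, B i (y i)]) (tilt a J (noise w))%:E
  = \prod_i normal_prob 0 1
      (if i \in J then [set z | B i (z + a i)%R] else B i).
Proof.
move Jn : #|J| => n; elim: n J Jn B => [|n IH] J Jn B mB.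
  have -> : J = finset.set0 by apply/eqP; rewrite -cards_eq0 Jn.
  rewrite (eq_integral (cst 1)); last first.
    by move=> w _; rewrite /tilt big1 => [|i _]; rewrite ?inE.
  rewrite integral_cst/=; last first.
    rewrite -[X in measurable X]setTI; apply: measurable_noise => //.
    exact: measurable_rect.
  rewrite mul1e.
  transitivity (P (\bigcap_(i in [set` finset.setT : {set I}]) (Z i @^-1` B i))).
    congr (P _); apply/seteqP; split => w /= h i => [_|]; first exact: h.
    by apply: h; rewrite /= inE.
  rewrite Zind//; apply: eq_big => i; first by rewrite inE.
  by rewrite !inE => _; exact: Zdist.
have [j jJ] : exists j, j \in J by apply/card_gt0P; rewrite Jn.
have J'n : #|J :\ j| = n by move: Jn; rewrite (cardsD1 j) jJ => -[].
pose upd C i := if i == j then C else B i.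
have mupd C : measurable C -> forall i, measurable (upd C i).
  by move=> mC i; rewrite /upd; case: ifP.
(* [W] collects the coordinates other than [j], with no constraint on [Z j]. *)
pose W w := (tilt a (J :\ j) (noise w) *
  \1_(noise @^-1` [set y | forall i, upd setT i (y i)]) w)%R.
pose c := \prod_(i | i != j) normal_prob 0 1
      (if i \in J then [set z | B i (z + a i)%R] else B i).
have c0 : 0 <= c by apply: prode_ge0 => i _; exact: measure_ge0.
have cfin : c \is a fin_num.
  apply: prode_fin_num => i _; apply: fin_num_measure.
  by case: ifP => _; [exact: measurable_shift|exact: mB].
have updE C w : (w \in noise @^-1` [set y | forall i, upd C i (y i)]) =
    (Z j w \in C) && (w \in noise @^-1` [set y | forall i, upd setT i (y i)]).
  apply/idP/andP; rewrite !inE/=.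
    move=> h; split; first by have := h j; rewrite /upd eqxx.
    by move=> i; have := h i; rewrite /upd; case: eqP.
  move=> [h1 h2] i; have := h2 i; rewrite /upd; case: eqP => // ->//.
have mrect B' : (forall i, measurable (B' i)) ->
    measurable (noise @^-1` [set y | forall i, B' i (y i)]).
  move=> mB'; rewrite -[X in measurable X]setTI; apply: measurable_noise => //.
  exact: measurable_rect.
have mT : measurable_fun setT (fun w => tilt a (J :\ j) (noise w)).
  apply: measurableT_comp => //; exact: measurable_tilt.
have mf : measurable_fun setT
    (fun z => (expR (a j * z - a j ^+ 2 / 2))%:E * (\1_(B j) z)%:E).
  apply: emeasurable_funM.
    apply/measurable_EFinP; apply: measurableT_comp => //.
    by apply: measurable_funB => //; exact: measurable_funM.
  by apply/measurable_EFinP; exact: measurable_indic.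
have f0 z : 0 <= (expR (a j * z - a j ^+ 2 / 2))%:E * (\1_(B j) z)%:E.
  by rewrite mule_ge0 ?lee_fin ?expR_ge0.
apply: (@eq_trans _ _ (\int[P]_w ((W w)%:E *
   ((expR (a j * Z j w - a j ^+ 2 / 2))%:E * (\1_(B j) (Z j w))%:E)))).
  rewrite integral_mkcond; apply: eq_integral => w _.
  rewrite patchE /W (tiltD1 _ _ jJ) -!EFinM !indicE.
  rewrite (_ : [set y | forall i, B i (y i)] = [set y | forall i, upd (B j) i
      (y i)]).
    rewrite (updE (B j)); case: (_ \in B j); case: (w \in _);
      by rewrite ?mulr1 ?mulr0 ?mul0r// mulrC.
  apply/seteqP; split => y /= h i; have := h i; rewrite /upd; by case: eqP =>
      [->|].
rewrite (@ge0_integral_indep _ _ T R R P (Z j) W (fine c)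
  (fun z => (expR (a j * z - a j ^+ 2 / 2))%:E * (\1_(B j) z)%:E)).
- rewrite (integral_gauss_comp j mf f0) fineK// normal_prob_tilt//; last first.
    by apply/measurable_EFinP; exact: measurable_indic.
  rewrite [RHS](bigD1 j)//= jJ muleC; congr (_ * _).
  rewrite -[RHS]mul1e -integral_cst.
    rewrite [RHS]integral_mkcond; apply: eq_integral => z _.
    rewrite patchE indicE.
    have [h|h] := pselect (B j (z + a j)%R).
      by rewrite (mem_set h) (@mem_set _ [set z | B j (z + a j)%R] z h).
    by rewrite (memNset h) (@memNset _ [set z | B j (z + a j)%R] z h).
  exact: measurable_shift.
- exact: (measurable_funP (Z j)).
- apply: measurable_funM => //.
  by apply: measurable_indic; apply: mrect; exact: mupd.
- by move=> w; rewrite mulr_ge0 ?tilt_ge0.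
- exact: fine_ge0.
- move=> C mC.
  transitivity (\int[P]_(w in noise @^-1` [set y | forall i, upd C i (y i)])
      (tilt a (J :\ j) (noise w))%:E).
    rewrite integral_mkcond [RHS]integral_mkcond; apply: eq_integral => w _.
    rewrite !patchE /W indicE (updE C) (_ : (w \in Z j @^-1` C) = (Z j w \in
        C))//.
    by case: (_ \in C); case: (w \in _); rewrite ?mulr1 ?mulr0.
  rewrite IH//; last exact: mupd.
  rewrite (bigD1 j)//= !inE eqxx/= /upd eqxx muleC fineK// Zdist//.
    congr (_ * _); apply: eq_bigr => i ij; rewrite !inE ij/=.
  by rewrite (negbTE ij).
- exact: mf.
- exact: f0.
Qed.

(** The Cameron-Martin formula. Both sides are integrals against finite
    measures on the product space, which agree on boxes. *)
Lemma ge0_integral_tilt (a : I -> R) (f : rspace R I -> \bar R) :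
  measurable_fun setT f -> (forall y, 0 <= f y) ->
  \int[P]_w ((tilt a finset.setT (noise w))%:E * f (noise w)) =
  \int[P]_w f (fun i => Z i w + a i)%R.
Proof.
move=> mf f0.
pose moved : T -> rspace R I := fun w i => (Z i w + a i)%R.
have mmoved : measurable_fun setT moved.
  by apply: measurable_fun_rspace => i; apply: measurable_funD.
pose noise' : {mfun T >-> rspace R I} :=
  HB.pack noise (isMeasurableFun.Build _ _ _ _ _ measurable_noise).
pose moved' : {mfun T >-> rspace R I} :=
  HB.pack moved (isMeasurableFun.Build _ _ _ _ _ mmoved).
pose W w := tilt a finset.setT (noise w).
have mW : measurable_fun setT W.
  by apply: measurableT_comp => //; exact: measurable_tilt.
pose V : {mfun T >-> R} := HB.pack W (isMeasurableFun.Build _ _ _ _ _ mW).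
have V0 : forall x, (0 <= V x)%R by move=> w; exact: tilt_ge0.
(* Boxes: independence splits both sides into one-dimensional factors. *)
have rect_eq (B : I -> set R) : (forall i, measurable (B i)) ->
    pushforward (mdensity P V0) noise' [set y | forall i, B i (y i)] =
    pushforward P moved' [set y | forall i, B i (y i)].
  move=> mB; rewrite /pushforward /mdensity/= integral_tilt_rect//.
  transitivity (P (\bigcap_(i in [set` finset.setT : {set I}])
      (Z i @^-1` [set z | B i (z + a i)%R]))).
    rewrite Zind; last by move=> i; exact: measurable_shift.
    apply: eq_big => i; first by rewrite inE.
    by rewrite !inE => _; rewrite Zdist//; exact: measurable_shift.
  congr (P _); apply/seteqP; split => w /= h i; last by move=> _; exact: h.
  by apply: h; rewrite /= inE.
rewrite (@ge0_integral_pushdensity _ _ _ _ _ P (pushforward P moved') noise W)//.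
- by rewrite ge0_integral_pushforward.
- apply: (@rspace_measure_unique _ _ (pushforward (mdensity P V0) noise')
    (pushforward P moved')); last exact: rect_eq.
  have := rect_eq (fun=> setT) (fun=> measurableT).
  rewrite (_ : [set y : rspace R I | _] = setT); last exact/seteqP.
  move=> /= ->; rewrite /pushforward preimage_setT.
  by rewrite probability_setT ltry.
Qed.

End cameron_martin.

(** * Conditional expectations and Bayes' formula for a Gaussian mixture *)

Section cond_expectation_unique.
Context d (T : measurableType d) (R : realType) (P : probability T R).
Context (I : finType) (Y : I -> T -> R).
Hypothesis mY : forall i, measurable_fun setT (Y i).
Local Open Scope ereal_scope.

Lemma sigma_gen_measurable A : sigma_gen Y A -> measurable A.
Proof.
rewrite -measurable_preimage_rspace => -[B mB <-].
have : measurable_fun setT ((fun w i => Y i w) : T -> rspace R I).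
  exact: measurable_fun_rspace.
exact.
Qed.

(** Both [{g < C}] and its complement belong to the sigma-algebra; integrating
    [C - g] over them shows that the L1 distance of [C] and [g] vanishes. *)
Lemma ae_eq_of_sigma_gen (C g : T -> R) :
  preimage_set_system setT C measurable `<=` sigma_gen Y ->
  preimage_set_system setT g measurable `<=` sigma_gen Y ->
  P.-integrable setT (EFin \o C) -> P.-integrable setT (EFin \o g) ->
  (forall A, sigma_gen Y A ->
     \int[P]_(w in A) (C w)%:E = \int[P]_(w in A) (g w)%:E) ->
  ae_eq P setT C g.
Proof.
move=> mC mg iC ig H.
pose TG := g_sigma_algebraType (\bigcup_i preimage_set_system setT (Y i)
    measurable).
have mC' : measurable_fun (setT : set TG) (C : TG -> R).
  by move=> _ B mB; apply: mC; exists B.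
have mg' : measurable_fun (setT : set TG) (g : TG -> R).
  by move=> _ B mB; apply: mg; exists B.
pose A : set T := [set w | (g w < C w)%R].
have GA : sigma_gen Y A.
  have mEg : measurable_fun (setT : set TG) (EFin \o g : TG -> \bar R).
    exact/measurable_EFinP.
  have mEC : measurable_fun (setT : set TG) (EFin \o C : TG -> \bar R).
    exact/measurable_EFinP.
  by have := measurable_lte measurableT mEg mEC; rewrite setTI.
have GAC : sigma_gen Y (~` A).
  exact: (@measurableC _ TG A).
have mA := sigma_gen_measurable GA.
have sub (B : set T) : measurable B -> forall f : T -> R,
    P.-integrable setT (EFin \o f) -> P.-integrable B (EFin \o f).
  by move=> mB f; apply: integrableS.
have iB : P.-integrable setT (EFin \o (C \- g)%R).
  by have := integrableB measurableT iC ig.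
have mCg := measurable_int _ iB.
have zero : \int[P]_w `|(C w - g w)%:E| = 0.
  rewrite -(setUv A) ge0_integral_setU//=; first last.
  - exact/disj_setPCl.
  - rewrite setUv; apply/measurable_EFinP; apply: measurableT_comp => //.
    by have /measurable_EFinP := mCg.
  - exact: measurableC.
  rewrite (eq_integral (fun w => (C w)%:E - (g w)%:E)); last first.
    move=> w; rewrite inE /A /= => gC.
    by rewrite gtr0_norm ?subr_gt0// EFinB.
  rewrite [X in _ + X](eq_integral (fun w => (g w)%:E - (C w)%:E)); last first.
    move=> w; rewrite inE /A /= => /negP; rewrite -leNgt => gC.
    by rewrite ler0_norm ?subr_le0// opprB EFinB.
  have mAC := measurableC mA.
  rewrite !integralB//; try exact: sub.
  rewrite !H// !subee ?adde0//; apply: integrable_fin_num => //; exact: sub.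
have : ae_eq P setT (EFin \o (C \- g)%R) (cst 0).
  exact/ae_eq_integral_abs.
apply: filterS => w /= h _; have := h Logic.I => -[] /eqP.
by rewrite subr_eq0 => /eqP.
Qed.

End cond_expectation_unique.

Section gaussian_mixture.
Context d (T : measurableType d) (R : realType) (P : probability T R).
Context (I : finType) (Z : I -> {RV P >-> R}).
Hypothesis Zgauss : forall i, standard_gaussian (Z i).
Hypothesis Zind : mutually_independent P Z.
(* [ev v] is the event that the signal is [X v], and [S] the signal itself,
   which is left unspecified outside these events (a null set). *)
Context (V : finType) (X : V -> I -> R) (ev : V -> set T) (s : R).
Hypothesis X1 : forall v, \sum_i X v i ^+ 2 = 1.
Hypothesis mev : forall v, measurable (ev v).
Hypothesis ev_disj : forall u v, u != v -> ev u `&` ev v = set0.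
Hypothesis evP : forall v, P (ev v) = (#|V|%:R^-1)%:E.
Hypothesis V0 : (0 < #|V|)%N.

Local Notation noise := ((fun w i => Z i w) : T -> rspace R I).
Local Notation M := (#|V|%:R : R).

Hypothesis ev_noise : forall v (B : set (rspace R I)), measurable B ->
  P (ev v `&` noise @^-1` B) = (P (ev v) * P (noise @^-1` B))%E.

Context (S : I -> T -> R).
Hypothesis mS : forall i, measurable_fun setT (S i).
Hypothesis SX : forall v w, ev v w -> forall i, S i w = X v i.

Definition obs i w := s * S i w + Z i w.

Local Notation Y := ((fun w i => obs i w) : T -> rspace R I).

Let M0 : 0 < M. Proof. by rewrite ltr0n. Qed.

Lemma measurable_noise : measurable_fun setT noise.
Proof. by apply: measurable_fun_rspace => i; exact: measurable_funP. Qed.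

Lemma measurable_obsi i : measurable_fun setT (obs i).
Proof. by apply: measurable_funD => //; exact: measurable_funM. Qed.

Lemma measurable_obs : measurable_fun setT Y.
Proof. by apply: measurable_fun_rspace => i; exact: measurable_obsi. Qed.

(** The likelihood ratio of [y] between the observation with signal [X v], of
    mean [s * X v] and hence of squared norm [s ^ 2], and pure noise. *)
Definition weight v (y : rspace R I) : R :=
  expR (s * (\sum_i X v i * y i) - s ^+ 2 / 2).

Lemma tilt_weight v y : tilt (fun i => s * X v i) finset.setT y = weight v y.
Proof.
rewrite /tilt /weight (eq_bigr (fun i => expR (s * X v i * y i - (s * X v i)
    ^+ 2 / 2))).
  rewrite -expR_sum; congr expR.
  rewrite sumrB mulr_sumr; congr (_ - _).
    by apply: eq_bigr => i _; rewrite mulrA.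
  rewrite -mulr_suml; congr (_ / _).
  by under eq_bigr do rewrite exprMn; rewrite -mulr_sumr X1 mulr1.
by move=> i _; rewrite inE.
Qed.

Lemma measurable_linear (c : I -> R) :
  measurable_fun setT (fun y : rspace R I => \sum_i c i * y i).
Proof.
apply: measurable_sum => i; apply: measurable_funM => //.
exact: measurable_coord.
Qed.

Lemma measurable_weight v : measurable_fun setT (weight v).
Proof.
apply: measurableT_comp => //; apply: measurable_funB => //.
by apply: measurable_funM => //; exact: measurable_linear.
Qed.

Lemma weight_gt0 v y : 0 < weight v y.
Proof. exact: expR_gt0. Qed.

Local Open Scope ereal_scope.

Lemma integral_ev_obs v (f : rspace R I -> R) :
  measurable_fun setT f -> (forall y, 0 <= f y)%R ->
  \int[P]_(w in ev v) (f (Y w))%:E =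
  \int[P]_w (weight v (noise w) * f (noise w) / M)%:E.
Proof.
move=> mf f0.
have mEf : measurable_fun setT (EFin \o f) by exact/measurable_EFinP.
pose fs (y : rspace R I) := f (fun i => y i + s * X v i)%R.
have mfs : measurable_fun setT fs.
  apply: (measurableT_comp mf); apply: measurable_fun_rspace => i.
  by apply: measurable_funD => //; exact: measurable_coord.
transitivity (\int[P]_w ((\1_(ev v) w)%:E * (fs (noise w))%:E)).
  rewrite integral_mkcond; apply: eq_integral => w _.
  rewrite patchE indicE; case: ifPn => [|_]; last by rewrite mul0e.
  rewrite inE mul1e => evw; congr (f _)%:E; apply/funext => i.
  by rewrite /obs (SX evw) addrC.
rewrite (@ge0_integral_indep _ _ _ _ _ P noise (\1_(ev v)) M^-1%R (EFin \o fs))//.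
- have := ge0_integral_tilt Zgauss Zind (fun i => s * X v i)%R mEf.
  move=> /= /(_ (fun y => f0 y)) <-.
  rewrite -ge0_integralZl//=.
  + apply: eq_integral => w _; rewrite tilt_weight -!EFinM; congr (_%:E).
    by rewrite mulrC.
  + apply: emeasurable_funM; apply/measurable_EFinP.
      by apply: (measurableT_comp (measurable_tilt _ _)); exact: measurable_noise.
    by apply: (measurableT_comp mf); exact: measurable_noise.
  + by move=> w _; rewrite mule_ge0 ?lee_fin ?tilt_ge0.
- exact: measurable_noise.
- move=> B mB.
  have mnB : measurable (noise @^-1` B).
    by have := measurable_noise measurableT mB; rewrite setTI.
  by rewrite integral_indic// -(evP v); exact: ev_noise.
- exact/measurable_EFinP.
- by move=> y; rewrite /= lee_fin; exact: f0.
Qed.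

Lemma ae_ev : {ae P, forall w, exists v, ev v w}.
Proof.
have mU : measurable (\big[setU/set0]_v ev v) by exact: bigsetU_measurable.
have PU : P (\big[setU/set0]_v ev v) = 1.
  rewrite -bigcup_seq measure_fin_bigcup//; last first.
    by move=> u v _ _ [w uv]; apply/eqP/negPn/negP => /ev_disj E; rewrite E in uv.
  rewrite -fsbig_seq ?index_enum_uniq//.
  rewrite (eq_bigr (fun=> (M^-1)%:E)) => [|v _]; last exact: evP.
  rewrite sumEFin sumr_const -[X in X%:E]mulr_natr mulVf// ?gt_eqF//.
exists (~` \big[setU/set0]_v ev v); split.
- exact: measurableC.
- by rewrite probability_setC// PU subee.
- move=> w /= h; apply: contra_not h; rewrite -bigcup_seq => -[v _ evw].
  by exists v.
Qed.

(** Bayes' formula in integrated form: means of functions of the signal and of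
    the observation become means under pure noise. *)
Lemma integral_mixture (F : T -> R) (f : V -> rspace R I -> R) :
  measurable_fun setT F ->
  (forall v, measurable_fun setT (f v)) -> (forall v y, 0 <= f v y)%R ->
  (forall v w, ev v w -> F w = f v (Y w)) ->
  \int[P]_w (F w)%:E =
  \int[P]_w ((\sum_v weight v (noise w) * f v (noise w)) / M)%:E.
Proof.
move=> mF mf f0 Ff.
have mfY v : measurable_fun setT (fun w => f v (Y w)).
  by apply: (measurableT_comp (mf v)); exact: measurable_obs.
have mfn v : measurable_fun setT (fun w => f v (noise w)).
  by apply: (measurableT_comp (mf v)); exact: measurable_noise.
have mwn v : measurable_fun setT (fun w => weight v (noise w)).
  by apply: (measurableT_comp (measurable_weight v)); exact: measurable_noise.
transitivity (\int[P]_w (\sum_v (\1_(ev v) w * f v (Y w))%:E)).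
  apply: ae_eq_integral => //.
  - exact/measurable_EFinP.
  - apply: emeasurable_sum => v; apply/measurable_EFinP.
    by apply: measurable_funM => //; exact: measurable_indic.
  - move: ae_ev; apply: filterS => w -[v evw] _ /=.
    rewrite (bigD1 v)//= big1 ?adde0; last first.
      move=> u uv; rewrite indicE memNset ?mul0r// => evu.
      by have := ev_disj uv; move/seteqP => [/(_ w)+ _]; apply.
    by rewrite indicE mem_set// mul1r (Ff _ _ evw).
rewrite ge0_integral_sum//; last 2 first.
- move=> v; apply/measurable_EFinP.
  by apply: measurable_funM => //; exact: measurable_indic.
- by move=> v w _; rewrite lee_fin mulr_ge0.
transitivity (\int[P]_w (\sum_v (weight v (noise w) * f v (noise w) / M)%:E)).
  rewrite ge0_integral_sum//; last 2 first.
  - move=> v; apply/measurable_EFinP.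
    by apply: measurable_funM => //; exact: measurable_funM.
  - by move=> v w _; rewrite lee_fin divr_ge0 ?mulr_ge0 ?f0 ?ltW ?weight_gt0.
  apply: eq_bigr => v _; rewrite -integral_ev_obs// [RHS]integral_mkcond.
  apply: eq_integral => w _; rewrite patchE indicE.
  by case: ifP; rewrite ?mul1r ?mul0r.
by apply: eq_integral => w _; rewrite sumEFin mulr_suml.
Qed.

Definition evidence (y : rspace R I) : R := \sum_v weight v y.

Definition posterior_mean i (y : rspace R I) : R :=
  (\sum_v weight v y * X v i) / evidence y.

Lemma evidence_gt0 y : (0 < evidence y)%R.
Proof.
have /card_gt0P [v _] := V0.
rewrite /evidence (bigD1 v)//= ltr_wpDr ?weight_gt0//.
by apply: sumr_ge0 => u _; rewrite ltW ?weight_gt0.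
Qed.

Lemma measurable_evidence : measurable_fun setT evidence.
Proof. by apply: measurable_sum => v; exact: measurable_weight. Qed.

Lemma measurable_posterior_mean i : measurable_fun setT (posterior_mean i).
Proof.
apply: measurable_funM.
  apply: measurable_sum => v; apply: measurable_funM => //.
  exact: measurable_weight.
have -> : (fun y => (evidence y)^-1)%R = (fun y => expR (- ln (evidence y)))%R.
  by apply/funext => y; rewrite expRN lnK// posrE evidence_gt0.
apply: measurableT_comp => //; apply: measurableT_comp => //.
exact: (measurableT_comp (@measurable_ln R) measurable_evidence).
Qed.

Lemma signal_le1 v i : (`|X v i| <= 1)%R.
Proof.
rewrite -(@ler_pXn2r _ 2)// ?nnegrE// expr1n real_normK ?num_real//.
rewrite -(X1 v) (bigD1 i)//= lerDl; apply: sumr_ge0 => j _; exact: sqr_ge0.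
Qed.

Lemma posterior_mean_le1 i y : (`|posterior_mean i y| <= 1)%R.
Proof.
rewrite /posterior_mean normrM [X in (_ * X)%R]gtr0_norm ?invr_gt0
    ?evidence_gt0//.
rewrite ler_pdivrMr ?evidence_gt0// mul1r.
apply: (le_trans (ler_norm_sum _ _ _)); apply: ler_sum => v _.
rewrite normrM gtr0_norm ?weight_gt0// ler_piMr ?signal_le1//.
by rewrite ltW ?weight_gt0.
Qed.

Lemma ae_S_le1 i : {ae P, forall w, (`|S i w| <= 1)%R}.
Proof.
by move: ae_ev; apply: filterS => w [v /SX ->]; exact: signal_le1.
Qed.

Lemma integrable_S i : P.-integrable setT (EFin \o S i).
Proof.
apply/integrableP; split; first exact/measurable_EFinP.
apply: (@le_lt_trans _ _ (\int[P]_w 1%:E)); last first.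
  rewrite integral_cst// mul1e.
  by apply: (@le_lt_trans _ _ 1); rewrite ?ltry// probability_le1.
apply: ae_ge0_le_integral => //.
- apply: measurableT_comp => //; exact/measurable_EFinP.
- by move: (ae_S_le1 i); apply: filterS => w h _; rewrite /= lee_fin.
Qed.

Lemma integrable_posterior_mean i : P.-integrable setT (EFin \o
    (posterior_mean i \o Y)).
Proof.
have mp : measurable_fun setT (posterior_mean i \o Y).
  by apply: (measurableT_comp (measurable_posterior_mean i)); exact:
      measurable_obs.
apply/integrableP; split; first exact/measurable_EFinP.
apply: (@le_lt_trans _ _ (\int[P]_w 1%:E)); last first.
  rewrite integral_cst// mul1e.
  by apply: (@le_lt_trans _ _ 1); rewrite ?ltry// probability_le1.
apply: ge0_le_integral => //.
- by apply: measurableT_comp => //; exact/measurable_EFinP.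
- by move=> w _; rewrite /= lee_fin posterior_mean_le1.
Qed.

(** The summands are shifted by 1 because integral_mixture is about nonnegative
    functions, while signals only satisfy [`|X v i| <= 1]. *)
Lemma integral_posterior_mean i A : sigma_gen obs A ->
  \int[P]_(w in A) (posterior_mean i (Y w))%:E = \int[P]_(w in A) (S i w)%:E.
Proof.
rewrite -measurable_preimage_rspace => -[B mB]; rewrite setTI => <-{A}.
set A := Y @^-1` B.
have mA : measurable A.
  by have := measurable_obs measurableT mB; rewrite setTI.
have mpY : measurable_fun setT (posterior_mean i \o Y).
  by apply: (measurableT_comp (measurable_posterior_mean i)); exact:
      measurable_obs.
have m1B : measurable_fun setT (\1_B : rspace R I -> R) by exact:
    measurable_indic.
have m1A : measurable_fun setT (\1_A : T -> R) by exact: measurable_indic.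
have eq1 : \int[P]_w (\1_A w * (posterior_mean i (Y w) + 1))%:E =
    \int[P]_w (\1_A w * (S i w + 1))%:E.
  rewrite (@integral_mixture _ (fun v y => \1_B y * (posterior_mean i y +
      1))%R); last 4 first.
  - by apply: measurable_funM => //; apply: measurable_funD.
  - move=> v; apply: measurable_funM => //; apply: measurable_funD => //.
    exact: measurable_posterior_mean.
  - move=> v y; rewrite mulr_ge0//.
    by have := posterior_mean_le1 i y; rewrite ler_norml => /andP[+ _];
        rewrite -subr_ge0 opprK.
  - by move=> v w _; rewrite !indicE.
  rewrite [RHS](@integral_mixture _ (fun v y => \1_B y * (X v i + 1))%R);
      last 4 first.
  - by apply: measurable_funM => //; apply: measurable_funD.
  - by move=> v; apply: measurable_funM.
  - move=> v y; rewrite mulr_ge0//.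
    by have := signal_le1 v i; rewrite ler_norml => /andP[+ _]; rewrite
        -subr_ge0 opprK.
  - by move=> v w /SX ->; rewrite !indicE.
  apply: eq_integral => w _; congr (_ / _)%:E%R.
  set y := noise w.
  under eq_bigr do rewrite mulrCA mulrDr mulr1.
  under [RHS]eq_bigr do rewrite mulrCA mulrDr mulr1.
  rewrite -!mulr_sumr !big_split/=; congr (_ * (_ + _))%R.
  by rewrite -mulr_suml mulrC /posterior_mean divfK// gt_eqF// evidence_gt0.
have split1 (f : T -> R) : P.-integrable setT (EFin \o f) ->
    \int[P]_w (\1_A w * (f w + 1))%:E = \int[P]_(w in A) (f w)%:E + P A.
  move=> fi.
  transitivity (\int[P]_(w in A) ((f w)%:E + 1)).
    rewrite [RHS]integral_mkcond; apply: eq_integral => w _.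
    by rewrite patchE indicE; case: ifP => _; rewrite ?mul1r ?mul0r.
  rewrite integralD//.
  - by rewrite integral_cst// mul1e.
  - exact: integrableS fi.
  - exact: finite_measure_integrable_cst.
move: eq1; rewrite !split1; last 2 first.
- exact: integrable_S.
- exact: integrable_posterior_mean.
have PA : P A \is a fin_num by exact: fin_num_measure.
by move/(congr1 (fun z => z - P A)); rewrite !addeK.
Qed.

Lemma cond_expectation_posterior_mean i (C : T -> R) :
  is_cond_expectation P (sigma_gen obs) (S i) C ->
  ae_eq P setT C (posterior_mean i \o Y).
Proof.
move=> [mC iC HC]; apply: (@ae_eq_of_sigma_gen _ _ _ _ _ obs) => //.
- exact: measurable_obsi.
- move=> _ [B mB <-]; rewrite -measurable_preimage_rspace.
  exists (posterior_mean i @^-1` B) => //.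
  by have := measurable_posterior_mean i measurableT mB; rewrite setTI.
- exact: integrable_posterior_mean.
- by move=> A GA; rewrite HC// integral_posterior_mean.
Qed.

Lemma measurable_of_condexp (F : T -> R) :
  preimage_set_system setT F measurable `<=` sigma_gen obs ->
  measurable_fun setT F.
Proof.
move=> mF _ B mB; apply: sigma_gen_measurable; first exact: measurable_obsi.
by apply: mF; exists B.
Qed.

Lemma mse_mixture (C : I -> T -> R) :
  (forall i, is_cond_expectation P (sigma_gen obs) (S i) (C i)) ->
  \int[P]_w (enorm (fun i => S i w - C i w) ^+ 2)%R%:E =
  \int[P]_w ((\sum_v weight v (noise w) *
     \sum_i (X v i - posterior_mean i (noise w)) ^+ 2) / M)%:E.
Proof.
move=> HC.
transitivity (\int[P]_w (\sum_i (S i w - posterior_mean i (Y w)) ^+ 2)%:E);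
    last first.
  apply: (@integral_mixture _ (fun v y => \sum_i (X v i - posterior_mean i y)
      ^+ 2)%R).
  - apply: measurable_sum => i; apply: measurable_funX; apply:
      measurable_funB => //.
    by apply: (measurableT_comp (measurable_posterior_mean i)); exact:
        measurable_obs.
  - move=> v; apply: measurable_sum => i; apply: measurable_funX.
    by apply: measurable_funB => //; exact: measurable_posterior_mean.
  - by move=> v y; apply: sumr_ge0 => i _; exact: sqr_ge0.
  - by move=> v w evw; apply: eq_bigr => i _; rewrite (SX evw).
have mC i : measurable_fun setT (C i).
  by apply: measurable_of_condexp; have [] := HC i.
rewrite (eq_integral (fun w => (\sum_i (S i w - C i w) ^+ 2)%:E)); last first.
  by move=> w _; rewrite /enorm sqr_sqrtr// sumr_ge0// => i _; exact: sqr_ge0.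
apply: ae_eq_integral => //.
- apply/measurable_EFinP; apply: measurable_sum => i; apply: measurable_funX.
  exact: measurable_funB.
- apply/measurable_EFinP; apply: measurable_sum => i; apply: measurable_funX.
  apply: measurable_funB => //.
  by apply: (measurableT_comp (measurable_posterior_mean i)); exact:
      measurable_obs.
- have : {ae P, forall w, forall i, C i w = posterior_mean i (Y w)}.
    apply: filter_forall => i; have := cond_expectation_posterior_mean (HC i).
    by apply: filterS => w /(_ Logic.I).
  apply: filterS => w h _ /=; congr (_%:E).
  by apply: eq_bigr => i _; rewrite h.
Qed.

End gaussian_mixture.

(** * Pointwise bounds on pairs of posterior weights *)

(** Here [g v] stands for [<X v, y>], [r] is the width of the typical window
    around [s], and [sigma u v] are the free parameters of the exponential
    bounds, later set to [1 / (1 + rho^+)] to minimise the resulting means. *)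
Section pointwise.
Context (R : realType) (V : finType) (s r : R) (g : V -> R) (rho : V -> V -> R).
Context (sigma : V -> V -> R).
Hypotheses (V0 : (0 < #|V|)%N) (s0 : 0 <= s) (r0 : 0 <= r).
Hypothesis rho1 : forall u v, `|rho u v| <= 1.
Hypothesis sigma01 : forall u v, 0 <= sigma u v <= 1.

Let wt v := expR (s * g v - s ^+ 2 / 2).
Let D := \sum_v wt v.

(** Chernoff's substitute for the indicator of [`|g v - s| > r]: smooth, with an
    explicit mean, and at least 1 on that event. *)
Definition atypical v :=
  expR (r * (g v - s) - r ^+ 2) + expR (- r * (g v - s) - r ^+ 2).

Lemma atypical_ge0 v : 0 <= atypical v.
Proof. by rewrite addr_ge0 ?expR_ge0. Qed.

Lemma typical_or v : `|g v - s| <= r \/ 1 <= atypical v.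
Proof.
case: (lerP `|g v - s| r) => [|h]; [by left|right].
have e1 x : 0 <= x -> 1 <= expR x by move=> x0; rewrite -expR0 ler_expR.
rewrite /atypical; case: (lerP 0 (g v - s)) => h1.
  rewrite ger0_norm// in h.
  by rewrite ler_wpDr ?expR_ge0// e1// subr_ge0 expr2 ler_wpM2l// ltW.
rewrite ltr0_norm// in h.
by rewrite ler_wpDl ?expR_ge0// e1// subr_ge0 expr2 mulNr -mulrN ler_wpM2l// ltW.
Qed.

Let wt_gt0 v : 0 < wt v. Proof. exact: expR_gt0. Qed.

Let D0 : 0 < D.
Proof.
have /card_gt0P [v _] := V0.
rewrite /D (bigD1 v)//= ltr_wpDr//.
by apply: sumr_ge0 => u _; rewrite ltW.
Qed.

Let wt_le_D v : wt v <= D.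
Proof.
rewrite /D (bigD1 v)//= lerDl; apply: sumr_ge0 => u _; exact: ltW.
Qed.

Let sum_pairl (b : V -> R) :
  \sum_u \sum_v wt u * wt v / D * b u = \sum_u wt u * b u.
Proof.
apply: eq_bigr => u _.
rewrite (eq_bigr (fun v => (wt u * b u / D) * wt v)); last by move=> v _; ring.
by rewrite -mulr_sumr -/D divfK// gt_eqF.
Qed.

Let sum_pairr (b : V -> R) :
  \sum_u \sum_v wt u * wt v / D * b v = \sum_u wt u * b u.
Proof.
rewrite exchange_big -[RHS]sum_pairl; apply: eq_bigr => u _.
by apply: eq_bigr => v _; rewrite (mulrC (wt v)).
Qed.

Let sum_pair : \sum_u \sum_v wt u * wt v / D = D.
Proof.
transitivity (\sum_u wt u * 1); last by under eq_bigr do rewrite mulr1.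
rewrite -sum_pairl; apply: eq_bigr => u _.
by apply: eq_bigr => v _; rewrite mulr1.
Qed.

(** A pair with an atypical member is paid for by [atypical], whose double sum
    collapses. For a typical pair, [wt v <= D] leaves [wt u], and the last
    exponential differs from it by the factors
    [exp ((1 - sigma) s (s + r - g u))] and [exp (sigma s (g v - s + r))], both
    at least 1. *)
Lemma far_pointwise (eps : R) : 0 <= eps ->
  \sum_u \sum_v wt u * wt v / D * (1 - rho u v) <=
  eps * D + (4 * \sum_u wt u * atypical u +
  2 * \sum_u \sum_(v | rho u v < 1 - eps)
     expR (sigma u v * s * (g u + g v) + (s ^+ 2 / 2 - 2 * sigma u v * s ^+ 2
         + s * r))).
Proof.
move=> eps0.
(* The first two terms are spread over all pairs, each member of an atypical
   pair being charged separately, so as to compare pair by pair. *)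
have -> : 4 * \sum_u wt u * atypical u =
    \sum_u \sum_v wt u * wt v / D * (2 * (atypical u + atypical v)).
  transitivity (2 * (\sum_u wt u * atypical u + \sum_u wt u * atypical u));
      first by ring.
  rewrite -{1}sum_pairl -sum_pairr -big_split/= mulr_sumr; apply: eq_bigr => u _.
  rewrite -big_split/= mulr_sumr; apply: eq_bigr => v _; ring.
rewrite -[X in eps * X]sum_pair !mulr_sumr -!big_split/=; apply: ler_sum => u _.
rewrite [X in _ + (_ + 2 * X)]big_mkcond/= !mulr_sumr -!big_split/=.
apply: ler_sum => v _.
set p := wt u * wt v / D.
have p0 : 0 <= p by rewrite /p divr_ge0 ?mulr_ge0 ?ltW.
have b0 : 0 <= p * (2 * (atypical u + atypical v)).
  by rewrite mulr_ge0// mulr_ge0// addr_ge0 ?atypical_ge0.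
case: ltP => h; last first.
  rewrite mulr0 addr0 ler_wpDr// mulrC ler_wpM2r//; lra.
have rle : 1 - rho u v <= 2 by have := rho1 u v; rewrite ler_norml =>
    /andP[]; lra.
apply: (@le_trans _ _ (p * 2)); first by rewrite ler_wpM2l.
apply: ler_wpDl; first exact: mulr_ge0.
set H := expR _.
have H0 : 0 <= H by exact: expR_ge0.
have [h1|h1] := typical_or u; last first.
  rewrite ler_wpDr ?mulr_ge0// ler_wpM2l//.
  by have := atypical_ge0 v; lra.
have [h2|h2] := typical_or v; last first.
  rewrite ler_wpDr ?mulr_ge0// ler_wpM2l//.
  by have := atypical_ge0 u; lra.
rewrite ler_wpDl// mulrC ler_wpM2l//.
apply: (@le_trans _ _ (wt u)).
  by rewrite /p -mulrA ler_piMr ?(ltW (wt_gt0 _))// ler_pdivrMr// mul1r.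
rewrite /wt /H ler_expR -subr_ge0.
have /andP[sg0 sg1] := sigma01 u v.
move: h1 h2; rewrite !ler_norml => /andP[h1 h1'] /andP[h2 h2'].
have -> : sigma u v * s * (g u + g v) +
    (s ^+ 2 / 2 - 2 * sigma u v * s ^+ 2 + s * r) - (s * g u - s ^+ 2 / 2) =
  (1 - sigma u v) * s * (s + r - g u) + sigma u v * s * (g v - s + r) by field.
by rewrite addr_ge0// !mulr_ge0//; lra.
Qed.

(** If [D <= tau * M] the whole sum is at most [D]. Otherwise [D] is replaced by
    [tau * M], and for a typical pair the last exponential exceeds
    [wt u * wt v] by the factor
    [exp ((1 - sigma) s ((s + r - g u) + (s + r - g v)))], at least 1. *)
Lemma near_pointwise (eps tau M : R) : 0 <= eps -> 0 < tau -> 0 < M ->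
  \sum_u \sum_v wt u * wt v / D * rho u v <=
  eps * D + (2 * \sum_u wt u * atypical u + (tau * M +
  (tau * M)^-1 * \sum_u \sum_(v | eps < rho u v)
     expR (sigma u v * s * (g u + g v) +
       (s ^+ 2 - 2 * sigma u v * s ^+ 2 + 2 * (1 - sigma u v) * s * r)))).
Proof.
move=> eps0 tau0 M0.
have tM : 0 < tau * M by rewrite mulr_gt0.
have at0 : 0 <= \sum_u wt u * atypical u.
  by apply: sumr_ge0 => u _; rewrite mulr_ge0 ?atypical_ge0// ltW.
case: (lerP D (tau * M)) => hD.
  have : \sum_u \sum_v wt u * wt v / D * rho u v <= D.
    rewrite -[leRHS]sum_pair; apply: ler_sum => u _; apply: ler_sum => v _.
    rewrite ler_piMr ?divr_ge0 ?mulr_ge0 ?(ltW (wt_gt0 _)) ?(ltW D0)//.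
    by have := rho1 u v; rewrite ler_norml => /andP[].
  move=> /le_trans; apply; apply: (le_trans hD).
  rewrite addrA; apply: ler_wpDl.
    by rewrite addr_ge0 ?mulr_ge0 ?(ltW D0).
  rewrite lerDl mulr_ge0 ?invr_ge0 ?(ltW tM)//.
  by do 2 (apply: sumr_ge0 => ? _); exact: expR_ge0.
apply: (@le_trans _ _ (eps * D + (2 * \sum_u wt u * atypical u +
  (tau * M)^-1 * \sum_u \sum_(v | eps < rho u v)
     expR (sigma u v * s * (g u + g v) +
       (s ^+ 2 - 2 * sigma u v * s ^+ 2 + 2 * (1 - sigma u v) * s * r)))));
           last first.
  by rewrite !lerD2l ler_wpDl// ltW.
have -> : 2 * \sum_u wt u * atypical u =
    \sum_u \sum_v wt u * wt v / D * (atypical u + atypical v).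
  transitivity (\sum_u wt u * atypical u + \sum_u wt u * atypical u); first
      by ring.
  rewrite -{1}sum_pairl -sum_pairr -big_split/=; apply: eq_bigr => u _.
  rewrite -big_split/=; apply: eq_bigr => v _; ring.
rewrite -[X in eps * X]sum_pair !mulr_sumr -!big_split/=; apply: ler_sum => u _.
rewrite [X in _ + (_ + _ * X)]big_mkcond/= !mulr_sumr -!big_split/=.
apply: ler_sum => v _.
set p := wt u * wt v / D.
have p0 : 0 <= p by rewrite /p divr_ge0 ?mulr_ge0 ?ltW.
have b0 : 0 <= p * (atypical u + atypical v).
  by rewrite mulr_ge0// addr_ge0 ?atypical_ge0.
case: ltP => h; last first.
  by rewrite mulr0 addr0 ler_wpDr// mulrC ler_wpM2r.
have rle : rho u v <= 1 by have := rho1 u v; rewrite ler_norml => /andP[].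
apply: (@le_trans _ _ (p * 1)); first by rewrite ler_wpM2l.
apply: ler_wpDl; first exact: mulr_ge0.
set H := expR _.
have H0 : 0 <= H by exact: expR_ge0.
have [h1|h1] := typical_or u; last first.
  rewrite ler_wpDr ?mulr_ge0// ?invr_ge0 ?(ltW tM)// ler_wpM2l//.
  by have := atypical_ge0 v; lra.
have [h2|h2] := typical_or v; last first.
  rewrite ler_wpDr ?mulr_ge0// ?invr_ge0 ?(ltW tM)// ler_wpM2l//.
  by have := atypical_ge0 u; lra.
rewrite ler_wpDl// mulr1 mulrC /p ler_pM ?invr_ge0 ?mulr_ge0 ?(ltW D0) ?(ltW
    (wt_gt0 _))//; last first.
  by rewrite lef_pV2 ?posrE// ltW.
rewrite /wt /H -expRD ler_expR -subr_ge0.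
have /andP[sg0 sg1] := sigma01 u v.
move: h1 h2; rewrite !ler_norml => /andP[h1 h1'] /andP[h2 h2'].
set E := _ - _.
have -> : E = (1 - sigma u v) * s * ((s + r - g u) + (s + r - g v)).
  by rewrite /E; field.
by rewrite !mulr_ge0//; lra.
Qed.

End pointwise.

(** * The mean square error in terms of pairwise overlaps *)

Section gaussian_expectation.
Context d (T : measurableType d) (R : realType) (P : probability T R).
Context (I : finType) (Z : I -> {RV P >-> R}).
Hypothesis Zgauss : forall i, standard_gaussian (Z i).
Hypothesis Zind : mutually_independent P Z.

Local Notation noise := ((fun w i => Z i w) : T -> rspace R I).

(** Bundling measurability, nonnegativity and the value of the mean makes the
    means of the pointwise bounds computable by closure properties. *)
Definition has_mean (U : rspace R I -> R) (x : R) :=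
  [/\ measurable_fun setT U, forall y, 0 <= U y &
      (\int[P]_w (U (noise w))%:E = x%:E)%E].

Let measurable_noise : measurable_fun setT noise.
Proof. by apply: measurable_fun_rspace => i; exact: measurable_funP. Qed.

Let integral_prob_cst (k : R) : (\int[P]_w k%:E = k%:E)%E.
Proof.
rewrite integral_cst// -[RHS]mule1; congr (_ * _)%E; exact: probability_setT.
Qed.

Lemma has_mean_expR (a : I -> R) (c : R) :
  has_mean (fun y => expR (\sum_i a i * y i + c))
           (expR ((\sum_i a i ^+ 2) / 2 + c)).
Proof.
have mU : measurable_fun setT (fun y : rspace R I => expR (\sum_i a i * y i + c)).
  apply: measurableT_comp => //; apply: measurable_funD => //.
  exact: measurable_linear.
split => //.
have cst_m : measurable_fun setT
    (cst (expR ((\sum_i a i ^+ 2) / 2 + c))%:E : rspace R I -> \bar R).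
  exact: measurable_cst.
have pos (y : rspace R I) : (0 <= cst (expR ((\sum_i a i ^+ 2) / 2 + c))%:E y)%E.
  by rewrite lee_fin expR_ge0.
have /= := ge0_integral_tilt Zgauss Zind a cst_m pos.
rewrite integral_prob_cst => <-.
apply: eq_integral => w _; rewrite -EFinM; congr (_%:E).
have -> : tilt a finset.setT (noise w) = \prod_i expR (a i * Z i w - a i ^+ 2
    / 2).
  by apply: eq_bigr => i _; rewrite inE.
rewrite -expR_sum -expRD sumrB -mulr_suml; congr expR; ring.
Qed.

Lemma has_meanD U1 U2 x1 x2 : has_mean U1 x1 -> has_mean U2 x2 ->
  has_mean (fun y => U1 y + U2 y) (x1 + x2).
Proof.
move=> [m1 p1 e1] [m2 p2 e2]; split.
- exact: measurable_funD.
- by move=> y; rewrite addr_ge0.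
- rewrite EFinD -e1 -e2 -ge0_integralD//.
  + by move=> w _; rewrite lee_fin.
  + by apply/measurable_EFinP; apply: (measurableT_comp m1).
  + by move=> w _; rewrite lee_fin.
  + by apply/measurable_EFinP; apply: (measurableT_comp m2).
Qed.

Lemma has_meanZ k U x : 0 <= k -> has_mean U x ->
  has_mean (fun y => k * U y) (k * x).
Proof.
move=> k0 [m1 p1 e1]; split.
- exact: measurable_funM.
- by move=> y; rewrite mulr_ge0.
- rewrite EFinM -e1 -ge0_integralZl//.
  + by apply/measurable_EFinP; apply: (measurableT_comp m1).
  + by move=> w _; rewrite lee_fin.
Qed.

Lemma has_mean_cst k : 0 <= k -> has_mean (fun=> k) k.
Proof.
move=> k0; split => //.
Qed.

Lemma has_mean_sum (J : Type) (s : seq J) (Q : pred J) U x :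
  (forall j, has_mean (U j) (x j)) ->
  has_mean (fun y => \sum_(j <- s | Q j) U j y) (\sum_(j <- s | Q j) x j).
Proof.
move=> h; elim: s => [|j s IH].
  rewrite big_nil (_ : (fun _ => _) = fun=> 0); first exact: has_mean_cst.
  by apply/funext => y; rewrite big_nil.
rewrite big_cons.
rewrite (_ : (fun _ => _) = fun y => (if Q j then U j y + \sum_(j <- s | Q j)
    U j y
   else \sum_(j <- s | Q j) U j y)); last first.
  by apply/funext => y; rewrite big_cons.
by case: (Q j) => //; exact: has_meanD.
Qed.

Lemma has_mean_ext U U' x x' : U =1 U' -> x = x' -> has_mean U x -> has_mean
    U' x'.
Proof. by move=> /funext -> ->. Qed.

Lemma has_mean_le (F U : rspace R I -> R) x :
  measurable_fun setT F -> (forall y, 0 <= F y <= U y) -> has_mean U x ->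
  (\int[P]_w (F (noise w))%:E <= x%:E)%E.
Proof.
move=> mF FU [mU U0 <-]; apply: ge0_le_integral => //.
- by move=> w _; rewrite lee_fin; have /andP[] := FU (noise w).
- by apply/measurable_EFinP; apply: (measurableT_comp mF).
- by apply/measurable_EFinP; apply: (measurableT_comp mU).
- by move=> w _; rewrite lee_fin; have /andP[] := FU (noise w).
Qed.

Context (V : finType) (X : V -> I -> R) (s r : R).
Hypothesis X1 : forall v, \sum_i X v i ^+ 2 = 1.
Hypothesis V0 : (0 < #|V|)%N.
Hypotheses (s0 : 0 <= s) (r0 : 0 <= r).

Local Notation M := (#|V|%:R : R).
Let M0 : 0 < M. Proof. by rewrite ltr0n. Qed.

Let iM0 : 0 <= M^-1. Proof. by rewrite invr_ge0 ltW. Qed.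

Definition overlap u v := \sum_i X u i * X v i.

(** The value of [sigma] that minimises [sigma^2 (1 + rho) - 2 sigma], the
    leading part of the mean exponents, when [rho >= 0]; the positive part
    keeps it in [0, 1] when the signals are negatively correlated. *)
Definition shrinkage u v := (1 + Num.max (overlap u v) 0)^-1.

Lemma overlap_le1 u v : `|overlap u v| <= 1.
Proof.
rewrite ler_norml; apply/andP; split.
  have : 0 <= \sum_i (X u i + X v i) ^+ 2 by apply: sumr_ge0 => i _; exact:
      sqr_ge0.
  under eq_bigr do rewrite sqrrD.
  rewrite !big_split/= !X1 -/(overlap u v); lra.
have : 0 <= \sum_i (X u i - X v i) ^+ 2 by apply: sumr_ge0 => i _; exact: sqr_ge0.
under eq_bigr do rewrite sqrrB.
rewrite !big_split/= !X1 sumrN big_split/= -/(overlap u v); lra.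
Qed.

Lemma shrinkage01 u v : 0 <= shrinkage u v <= 1.
Proof.
rewrite /shrinkage; have h : 0 <= Num.max (overlap u v) 0 by rewrite le_max
    lexx orbT.
rewrite invr_ge0 addr_ge0//= invf_le1 ?ltr_pwDl//.
by rewrite lerDl.
Qed.

Lemma sqr_sum_signal u v (c : R) :
  \sum_i (c * (X u i + X v i)) ^+ 2 = c ^+ 2 * (2 * (1 + overlap u v)).
Proof.
under eq_bigr do rewrite exprMn sqrrD.
rewrite -mulr_sumr !big_split/= !X1 -/(overlap u v); congr (_ * _); lra.
Qed.

Let sum_cst (x : R) : \sum_(u : V) x = x * M.
Proof. by rewrite sumr_const [RHS]mulr_natr. Qed.

Let g (y : rspace R I) v := \sum_i X v i * y i.

Lemma has_mean_weight v : has_mean (weight X s v) 1.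
Proof.
have := has_mean_expR (fun i => s * X v i) (- (s ^+ 2 / 2)).
apply: has_mean_ext => [y|].
  by rewrite /weight mulr_sumr; under eq_bigr do rewrite -mulrA.
by under eq_bigr do rewrite exprMn; rewrite -mulr_sumr X1 mulr1 subrr expR0.
Qed.

Lemma has_mean_evidence : has_mean (evidence X s) M.
Proof.
have := has_mean_sum (index_enum V) xpredT has_mean_weight.
by apply: has_mean_ext => [y//|]; rewrite sumr_const.
Qed.

(** Under [weight v], [<X v, y> - s] is a standard Gaussian variable, whose
    moment generating function at [r] and [- r] is [exp (r^2 / 2)]; the factor
    [exp (- r^2)] leaves [exp (- r^2 / 2)]. *)
Lemma has_mean_atypical v :
  has_mean (fun y => weight X s v y * atypical s r (g y) v) (2 * expR (- (r
      ^+ 2 / 2))).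
Proof.
have h (q : R) : q ^+ 2 = r ^+ 2 -> has_mean
    (fun y => weight X s v y * expR (q * (g y v - s) - r ^+ 2))
    (expR (- (r ^+ 2 / 2))).
  move=> qr.
  have := has_mean_expR (fun i => (s + q) * X v i) (- (s ^+ 2 / 2) - q * s -
      r ^+ 2).
  apply: has_mean_ext => [y|].
    rewrite /weight -expRD; congr expR.
    under eq_bigr do rewrite -mulrA.
    rewrite -mulr_sumr -/(g y v); ring.
  under eq_bigr do rewrite exprMn.
  by rewrite -mulr_sumr X1 mulr1 -qr; congr expR; field.
have := has_meanD (h r erefl) (h (- r) (sqrrN r)).
apply: has_mean_ext => [y|]; first by rewrite /atypical [RHS]mulrDr.
ring.
Qed.

Lemma has_mean_pair u v (c e : R) :
  has_mean (fun y => expR (c * (g y u + g y v) + e))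
    (expR (c ^+ 2 * (1 + overlap u v) + e)).
Proof.
have := has_mean_expR (fun i => c * (X u i + X v i)) e.
apply: has_mean_ext => [y|].
  congr (expR (_ + _)); rewrite /g -big_split mulr_sumr; apply: eq_bigr => i _.
  by rewrite -mulrA mulrDl.
by rewrite sqr_sum_signal; congr (expR (_ + _)); field.
Qed.

Definition mse_density (y : rspace R I) : R :=
  (\sum_v weight X s v y * \sum_i (X v i - posterior_mean X s i y) ^+ 2) / M.

(* [|posterior mean|^2 * D], as a sum over pairs of posterior samples. *)
Let gram y : \sum_i posterior_mean X s i y ^+ 2 * evidence X s y =
  \sum_u \sum_v weight X s u y * weight X s v y / evidence X s y * overlap u v.
Proof.
have D0 : evidence X s y != 0 by rewrite gt_eqF// evidence_gt0.
transitivity (\sum_i (\sum_u weight X s u y * X u i) * (\sum_v weight X s v y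
    * X v i)
   / evidence X s y).
  by apply: eq_bigr => i _; rewrite /posterior_mean; field.
under eq_bigr do rewrite big_distrlr/= mulr_suml.
rewrite exchange_big; apply: eq_bigr => u _.
under eq_bigr do rewrite mulr_suml.
rewrite exchange_big; apply: eq_bigr => v _.
rewrite /overlap mulr_sumr; apply: eq_bigr => i _; field.
by [].
Qed.

(* The signals being unit vectors, the posterior variance is one minus the
   squared norm of the posterior mean. *)
Let mse_densityE y : mse_density y * M =
  evidence X s y - \sum_u \sum_v weight X s u y * weight X s v y / evidence X
      s y * overlap u v.
Proof.
have D0 : evidence X s y != 0 by rewrite gt_eqF// evidence_gt0.
rewrite /mse_density divfK ?gt_eqF//.
transitivity (\sum_v (weight X s v y + (weight X s v y * (\sum_i
    posterior_mean X s i y ^+ 2)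
   - \sum_i (weight X s v y * X v i) * (2 * posterior_mean X s i y)))).
  apply: eq_bigr => v _.
  under eq_bigr do rewrite sqrrB.
  rewrite !big_split/= X1 sumrN sumrMnl mulrDr mulrDr mulrN mulr1.
  rewrite -addrA [X in _ + X]addrC; congr (_ + (_ - _)).
  rewrite -sumrMnl mulr_sumr; apply: eq_bigr => i _; ring.
rewrite big_split/= -/(evidence X s y) sumrB -mulr_suml -/(evidence X s y) -gram.
congr (_ + _).
rewrite exchange_big/= mulr_sumr -sumrB -sumrN; apply: eq_bigr => i _.
rewrite -mulr_suml (_ : \sum_v _ = posterior_mean X s i y * evidence X s y);
    last first.
  by rewrite /posterior_mean divfK.
ring.
Qed.

Let sum_weights y :
  \sum_u \sum_v weight X s u y * weight X s v y / evidence X s y = evidence X s y.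
Proof.
rewrite [RHS]/evidence; apply: eq_bigr => u _.
rewrite -mulr_suml -mulr_sumr -/(evidence X s y) mulfK//.
by rewrite gt_eqF// evidence_gt0.
Qed.

Lemma mse_density_ge0 y : 0 <= mse_density y.
Proof.
rewrite /mse_density divr_ge0// sumr_ge0// => v _.
rewrite mulr_ge0 ?(ltW (weight_gt0 _ _ _ _))// sumr_ge0// => i _; exact: sqr_ge0.
Qed.

Lemma measurable_mse_density : measurable_fun setT mse_density.
Proof.
apply: measurable_funM => //; apply: measurable_sum => v; apply: measurable_funM.
  exact: measurable_weight.
apply: measurable_sum => i; apply: measurable_funX; apply: measurable_funB => //.
exact: measurable_posterior_mean.
Qed.

Lemma mse_density_le1 : (\int[P]_w (mse_density (noise w))%:E <= 1)%E.
Proof.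
have := has_meanZ iM0 has_mean_evidence.
rewrite mulVf ?gt_eqF// => h; apply: (has_mean_le _ _ h).
- exact: measurable_mse_density.
- move=> y; rewrite mse_density_ge0/= ler_pdivlMl// mulrC mse_densityE gerBl
    -gram.
  by rewrite sumr_ge0// => i _; rewrite mulr_ge0 ?sqr_ge0// ltW// evidence_gt0.
Qed.

Lemma mse_density_far (eps : R) : 0 <= eps ->
  (\int[P]_w (mse_density (noise w))%:E <=
   (eps + 8 * expR (- (r ^+ 2 / 2)) + 2 * (M^-1 * \sum_u \sum_(v | (overlap u
       v < 1 - eps)%R)
     expR (s ^+ 2 * (1 / 2 - shrinkage u v) + s * r))%R)%:E)%E.
Proof.
move=> eps0.
have h : has_mean (fun y => M^-1 * (eps * evidence X s y +
   (4 * \sum_u weight X s u y * atypical s r (g y) u +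
    2 * \sum_u \sum_(v | overlap u v < 1 - eps)
     expR (shrinkage u v * s * (g y u + g y v) +
       (s ^+ 2 / 2 - 2 * shrinkage u v * s ^+ 2 + s * r)))))
  (M^-1 * (eps * M + (4 * \sum_(u : V) 2 * expR (- (r ^+ 2 / 2)) +
    2 * \sum_u \sum_(v | overlap u v < 1 - eps)
      expR ((shrinkage u v * s) ^+ 2 * (1 + overlap u v) +
       (s ^+ 2 / 2 - 2 * shrinkage u v * s ^+ 2 + s * r))))).
  apply: has_meanZ; first by rewrite invr_ge0 ltW.
  apply: has_meanD; first by apply: has_meanZ => //; exact: has_mean_evidence.
  apply: has_meanD; apply: has_meanZ => //; apply: has_mean_sum => u.
    exact: has_mean_atypical.
  by apply: has_mean_sum => v; exact: has_mean_pair.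
apply: (@le_trans _ _ (M^-1 * (eps * M + (4 * \sum_(u : V) 2 * expR (- (r ^+
    2 / 2)) +
    2 * \sum_u \sum_(v | overlap u v < 1 - eps)
      expR ((shrinkage u v * s) ^+ 2 * (1 + overlap u v) +
       (s ^+ 2 / 2 - 2 * shrinkage u v * s ^+ 2 + s * r)))))%:E).
  apply: (has_mean_le measurable_mse_density _ h) => y.
  rewrite mse_density_ge0/= ler_pdivlMl// mulrC mse_densityE.
  have := far_pointwise (g y) V0 s0 r0 overlap_le1 shrinkage01 eps0.
  apply: le_trans.
  rewrite -{1}sum_weights -sumrB; apply: ler_sum => u _.
  by rewrite -sumrB; apply: ler_sum => v _; rewrite mulrBr mulr1.
rewrite lee_fin sum_cst !mulrDr -!addrA; apply: lerD.
  by rewrite mulrCA mulVf ?gt_eqF// mulr1.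
apply: lerD.
  rewrite le_eqVlt; apply/orP; left; apply/eqP; field.
  by rewrite gt_eqF.
rewrite mulrCA ler_wpM2l// ler_wpM2l ?invr_ge0 ?(ltW M0)//.
apply: ler_sum => u _; apply: ler_sum => v _; rewrite ler_expR.
have /andP[c0 c1] := shrinkage01 u v.
suff : (shrinkage u v) ^+ 2 * (1 + overlap u v) <= shrinkage u v.
  move=> /(ler_wpM2r (sqr_ge0 s)) hh; rewrite exprMn; nra.
rewrite expr2 -mulrA ler_piMr// /shrinkage mulrC ler_pdivrMr ?mul1r ?lerD2l.
  by rewrite le_max lexx.
by rewrite ltr_pwDl// le_max lexx orbT.
Qed.

Lemma mse_density_near (eps tau : R) : 0 <= eps -> 0 < tau ->
  ((1 - (eps + 4 * expR (- (r ^+ 2 / 2)) + tau +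
    (M^-1 / M / tau) * \sum_u \sum_(v | (eps < overlap u v)%R)
     expR (s ^+ 2 * (1 - shrinkage u v) + 2 * s * r))%R)%:E <=
   \int[P]_w (mse_density (noise w))%:E)%E.
Proof.
move=> eps0 tau0.
pose G y := M^-1 * \sum_u \sum_v weight X s u y * weight X s v y / evidence X
    s y * overlap u v.
have G0 y : 0 <= G y.
  rewrite mulr_ge0 ?invr_ge0 ?(ltW M0)// -gram sumr_ge0// => i _.
  by rewrite mulr_ge0 ?sqr_ge0// ltW// evidence_gt0.
have GE y : G y = M^-1 * evidence X s y - mse_density y.
  by rewrite -[mse_density y](mulfK (lt0r_neq0 M0)) mse_densityE /G; ring.
have mG : measurable_fun setT G.
  rewrite (_ : G = fun y => M^-1 * evidence X s y - mse_density y); last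
      exact/funext.
  apply: measurable_funB; last exact: measurable_mse_density.
  by apply: measurable_funM => //; exact: measurable_evidence.
have h : has_mean (fun y => M^-1 * (eps * evidence X s y +
   (2 * \sum_u weight X s u y * atypical s r (g y) u +
    (tau * M + (tau * M)^-1 * \sum_u \sum_(v | eps < overlap u v)
     expR (shrinkage u v * s * (g y u + g y v) +
       (s ^+ 2 - 2 * shrinkage u v * s ^+ 2 + 2 * (1 - shrinkage u v) * s *
           r))))))
  (M^-1 * (eps * M + (2 * \sum_(u : V) 2 * expR (- (r ^+ 2 / 2)) +
    (tau * M + (tau * M)^-1 * \sum_u \sum_(v | eps < overlap u v)
      expR ((shrinkage u v * s) ^+ 2 * (1 + overlap u v) +
       (s ^+ 2 - 2 * shrinkage u v * s ^+ 2 + 2 * (1 - shrinkage u v) * s *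
           r)))))).
  have tM : 0 < tau * M by rewrite mulr_gt0.
  apply: has_meanZ; first by rewrite invr_ge0 ltW.
  apply: has_meanD; first by apply: has_meanZ => //; exact: has_mean_evidence.
  apply: has_meanD.
    apply: has_meanZ => //; apply: has_mean_sum => u; exact: has_mean_atypical.
  apply: has_meanD; first by apply: has_mean_cst; exact: ltW.
  apply: has_meanZ; first by rewrite invr_ge0 ltW.
  by apply: has_mean_sum => u; apply: has_mean_sum => v; exact: has_mean_pair.
have Gle : (\int[P]_w (G (noise w))%:E <=
  (eps + 4 * expR (- (r ^+ 2 / 2)) + tau +
    (M^-1 / M / tau) * \sum_u \sum_(v | (eps < overlap u v)%R)
     expR (s ^+ 2 * (1 - shrinkage u v) + 2 * s * r))%R%:E)%E.
  have := has_mean_le mG _ h; move=> /(_ _)/le_trans; apply.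
    move=> y; rewrite G0/= ler_pM2l ?invr_gt0//.
    exact: (near_pointwise (g y) V0 s0 r0 overlap_le1 shrinkage01 eps0 tau0 M0).
  rewrite lee_fin sum_cst !mulrDr -!addrA; apply: lerD.
    by rewrite mulrCA mulVf ?gt_eqF// mulr1.
  apply: lerD.
    rewrite le_eqVlt; apply/orP; left; apply/eqP; field.
    by rewrite gt_eqF.
  apply: lerD.
    by rewrite mulrCA mulVf ?gt_eqF// mulr1.
  rewrite mulrA (_ : M^-1 * (tau * M)^-1 = M^-1 / M / tau); last first.
    by rewrite invfM; ring.
  rewrite ler_wpM2l ?mulr_ge0 ?invr_ge0 ?(ltW M0) ?(ltW tau0)//.
  apply: ler_sum => u _; apply: ler_sum => v epsv; rewrite ler_expR.
  have /andP[c0 c1] := shrinkage01 u v.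
  have ov0 : 0 < overlap u v by exact: le_lt_trans epsv.
  have ce : (shrinkage u v) * (1 + overlap u v) = 1.
    by rewrite /shrinkage max_l ?(ltW ov0)// mulVf// gt_eqF// ltr_pwDl// ltW.
  have -> : (shrinkage u v * s) ^+ 2 * (1 + overlap u v) = shrinkage u v * s ^+ 2.
    rewrite (_ : _ * _ = shrinkage u v * s ^+ 2 * (shrinkage u v * (1 +
        overlap u v))).
      by rewrite ce mulr1.
    ring.
  have : 0 <= shrinkage u v * (s * r) by rewrite !mulr_ge0.
  nra.
(* The error and [G] add up to the mean of [D / M], the total mass. *)
have sum1 : (\int[P]_w (mse_density (noise w))%:E + \int[P]_w (G (noise
    w))%:E = 1)%E.
  rewrite -ge0_integralD//.
  - have [_ _] := has_meanZ iM0 has_mean_evidence.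
    rewrite mulVf ?gt_eqF// => <-.
    apply: eq_integral => w _; rewrite -EFinD GE; congr (_%:E); ring.
  - by move=> w _; rewrite lee_fin mse_density_ge0.
  - by apply/measurable_EFinP; apply: (measurableT_comp measurable_mse_density).
  - by move=> w _; rewrite lee_fin.
  - by apply/measurable_EFinP; apply: (measurableT_comp mG).
rewrite EFinB leeBlDr//.
by rewrite -sum1 leeD2l.
Qed.

End gaussian_expectation.

(** * Sparse vectors coded by pairs of sets, and counting them *)

Section binomial_bounds.
Local Open Scope nat_scope.

(** The probability that a uniform [k]-subset of [p] points contains [l] given
    points is at most [(k / p) ^ l]. *)
Lemma bin_sub_le p k l : l <= k <= p ->
  'C(p - l, k - l) * p ^ l <= 'C(p, k) * k ^ l.
Proof.
elim: l => [|l IH] /andP[lk kp]; first by rewrite !subn0 !expn0.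
have pl0 : 0 < p - l by rewrite subn_gt0 (leq_trans lk).
rewrite -(leq_pmul2l pl0).
have diag : (p - l) * 'C(p - l.+1, k - l.+1) = (k - l) * 'C(p - l, k - l).
  by rewrite !subnS mul_bin_diag prednK// subn_gt0.
rewrite mulnA diag expnS [p * _]mulnC mulnA -(mulnA (k - l)).
have := IH; rewrite (ltnW lk) kp => /(_ isT) {}IH.
apply: (@leq_trans ((k - l) * ('C(p, k) * k ^ l) * p)).
  by rewrite leq_mul2r leq_mul2l IH !orbT.
rewrite expnS.
have -> : (k - l) * ('C(p, k) * k ^ l) * p = ((k - l) * p) * ('C(p, k) * k ^
    l) by rewrite mulnAC.
have -> : (p - l) * ('C(p, k) * (k * k ^ l)) = (k * (p - l)) * ('C(p, k) * k ^ l).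
  by ring.
(* [(k - l) * p <= k * (p - l)] amounts to [k * l <= l * p]. *)
rewrite leq_mul2r; apply/orP; right; rewrite mulnBl mulnBr.
by apply: leq_sub2l; rewrite mulnC leq_mul2l kp orbT.
Qed.

Lemma bin_fact_le p k : 'C(p, k) * k`! <= p ^ k.
Proof.
rewrite bin_ffact; elim: k => // k IH.
by rewrite ffactnSr expnSr leq_mul// leq_subr.
Qed.

End binomial_bounds.

Lemma bin_le_expR (R : realType) p k : (0 < k)%N ->
  ('C(p, k)%:R : R) * k%:R ^+ k <= expR k%:R * p%:R ^+ k.
Proof.
move=> k0.
have kf : 0 < (k`!%:R : R) by rewrite ltr0n fact_gt0.
have h1 : (k%:R : R) ^+ k <= expR k%:R * k`!%:R.
  rewrite -ler_pdivrMr//; case: k k0 kf => // k _ kf.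
  by apply: le_trans (expR_ge1Dxn k _) => //; rewrite lerDr.
have h2 : ('C(p, k)%:R : R) * k`!%:R <= p%:R ^+ k.
  by rewrite -natrX -natrM ler_nat bin_fact_le.
apply: le_trans (ler_wpM2l _ h1) _ => //.
by rewrite mulrCA ler_wpM2l// expR_ge0.
Qed.

Section codes.
Context (pr : prior) (p k : nat).

(** A code is a support together with the set of its negative entries, which
    must be empty for the Bernoulli prior. *)
Definition sign_domain (B : {set 'I_p}) : {set 'I_p} :=
  if pr is Bernoulli then finset.set0 else B.

Definition is_code (c : {set 'I_p} * {set 'I_p}) :=
  (#|c.1| == k) && (c.2 \subset sign_domain c.1).

Definition sparse_code : predArgType := {c | is_code c}.
HB.instance Definition _ := Finite.on sparse_code.

Definition code_support (c : sparse_code) : {set 'I_p} := (val c).1.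

Lemma card_code_support c : #|code_support c| = k.
Proof. by rewrite /code_support; case: c => -[B S] /= /andP[/eqP]. Qed.

Local Open Scope nat_scope.

Definition sign_count := if pr is Bernoulli then 1 else 2 ^ k.

Lemma card_signs (B : {set 'I_p}) : #|B| = k -> #|powerset (sign_domain B)| =
    sign_count.
Proof.
by move=> Bk; rewrite card_powerset /sign_domain /sign_count;
  case: pr; rewrite ?cards0 ?Bk.
Qed.

Lemma card_code_above (A : {set 'I_p}) :
  #|[set c | A \subset code_support c]%SET| =
  sign_count * #|[set B : {set 'I_p} | (A \subset B) && (#|B| == k)]%SET|.
Proof.
rewrite -sum1dep_card.
rewrite -(@big_sub_cond _ _ _ _ is_code (fun c => A \subset c.1) (fun=> 1)).
transitivity (\sum_(B : {set 'I_p} | (A \subset B) && (#|B| == k))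
    \sum_(S in powerset (sign_domain B)) 1).
  rewrite pair_big_dep/=; apply: eq_bigl => -[B S] /=.
  by rewrite unfold_in /is_code/= powersetE andbC andbA.
rewrite (eq_bigr (fun=> sign_count)) => [|B /andP[_ /eqP Bk]].
  by rewrite sum_nat_const mulnC; congr (_ * _); apply: eq_card => B; rewrite inE.
by rewrite sum1_card card_signs.
Qed.

Lemma card_code : #|sparse_code| = sign_count * 'C(p, k).
Proof.
have -> : #|sparse_code| = #|[set c | finset.set0 \subset code_support c]%SET|.
  by rewrite -cardsT; apply: eq_card => c; rewrite !inE finset.sub0set.
rewrite card_code_above; congr (_ * _).
rewrite -[in RHS](card_ord p) -card_draws; apply: eq_card => B.
by rewrite !inE finset.sub0set.
Qed.

Lemma card_code_above_le (A : {set 'I_p}) : k <= p ->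
  #|[set c | A \subset code_support c]%SET| * p ^ #|A| <= #|sparse_code| * k
      ^ #|A|.
Proof.
move=> kp; case: (leqP #|A| k) => Ak; last first.
  rewrite (_ : #|[set c | A \subset code_support c]%SET| = 0) ?mul0n//.
  apply: eq_card0 => c; rewrite inE; apply/negP => /subset_leq_card.
  by rewrite card_code_support leqNgt Ak.
rewrite card_code_above card_code -!mulnA leq_mul2l.
rewrite (leq_trans _ (@bin_sub_le p k #|A| _)) ?orbT ?Ak//.
rewrite leq_mul2r; apply/orP; right.
have <- : #|~: A| = p - #|A| by rewrite cardsCs finset.setCK card_ord.
rewrite -cards_draws.
rewrite -(@card_in_imset _ _ (fun B => B :\: A)); last first.
  move=> B B'; rewrite !inE => /andP[AB _] /andP[AB' _] e.
  by rewrite -(finset.setID B A) -(finset.setID B' A) e (finset.setIidPr AB)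
      (finset.setIidPr AB').
apply: subset_leq_card; apply/fintype.subsetP => _ /imsetP[B + ->]; rewrite !inE.
move=> /andP[AB /eqP Bk]; rewrite cardsDS// Bk eqxx andbT.
by rewrite finset.subDset finset.setUCr finset.subsetT.
Qed.

End codes.

Section overlap_sums.
Context (pr : prior) (p k : nat) (R : realType).
Hypotheses (k0 : (0 < k)%N) (kp : (k <= p)%N).
Local Notation sparse_code := (sparse_code pr p k).
Local Notation M := (#|sparse_code|%:R : R).

Let kR0 : 0 < (k%:R : R). Proof. by rewrite ltr0n. Qed.
Let pR0 : 0 < (p%:R : R). Proof. by rewrite ltr0n (leq_trans k0). Qed.

(** Grouping the codes [v] by the trace [A] of their support on that of [u]: at
    most [M (k / p) ^ #|A|] of them contain [A], which cancels the allowed growth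
    of [h], and there are [2 ^ k] traces. *)
Lemma sum_code_le (u : sparse_code) (Q : pred sparse_code) (h : sparse_code
    -> R) (b : R) : 0 <= b ->
  (forall v, Q v -> h v <= b * (p%:R / k%:R) ^+ #|code_support u :&:
      code_support v|) ->
  \sum_(v | Q v) h v <= 2 ^+ k * M * b.
Proof.
move=> b0 hb.
have ratio0 : 0 < (p%:R / k%:R : R) by rewrite divr_gt0.
apply: (@le_trans _ _
  (\sum_v b * (p%:R / k%:R) ^+ #|code_support u :&: code_support v|)).
  rewrite big_mkcond; apply: ler_sum => v _; case: ifP => [|_]; first exact: hb.
  by rewrite mulr_ge0// exprn_ge0// ltW.
rewrite (partition_big (fun v => code_support u :&: code_support v)
  (fun A => A \in powerset (code_support u)))/=; last first.
  by move=> v _; rewrite powersetE finset.subsetIl.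
apply: (@le_trans _ _ (\sum_(A in powerset (code_support u)) M * b)).
  apply: ler_sum => A _.
  rewrite (eq_bigr (fun=> b * (p%:R / k%:R) ^+ #|A|)); last by move=> v /eqP ->.
  have -> c : \sum_(v : sparse_code | code_support u :&: code_support v == A) c =
      #|[set v : sparse_code | code_support u :&: code_support v ==
          A]%SET|%:R * c.
    by rewrite -sum1dep_card natr_sum mulr_suml; apply: eq_bigr => v _;
        rewrite mul1r.
  have NA : (#|[set v : sparse_code | code_support u :&: code_support v ==
      A]%SET| <=
      #|[set v : sparse_code | A \subset code_support v]%SET|)%N.
    apply: subset_leq_card; apply/fintype.subsetP => v; rewrite !inE => /eqP <-.
    exact: finset.subsetIr.
  apply: (@le_trans _ _ (#|[set v : sparse_code | A \subset code_support
      v]%SET|%:R *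
      (b * (p%:R / k%:R) ^+ #|A|))).
    by rewrite ler_wpM2r ?ler_nat// mulr_ge0// exprn_ge0// ltW.
  rewrite mulrCA [leRHS]mulrC ler_wpM2l//.
  rewrite expr_div_n mulrA ler_pdivrMr ?exprn_gt0//.
  by rewrite -!natrX -!natrM ler_nat card_code_above_le.
rewrite sumr_const card_powerset card_code_support -[leLHS]mulr_natl natrX mulrA.
by [].
Qed.

Lemma card_code_gt0 : (0 < #|sparse_code|)%N.
Proof.
by rewrite card_code muln_gt0 bin_gt0 kp andbT /sign_count; case: pr; rewrite
    ?expn_gt0.
Qed.

Lemma card_code_le : M * k%:R ^+ k <= 2 ^+ k * expR k%:R * p%:R ^+ k.
Proof.
rewrite card_code natrM -!mulrA; apply: ler_pM => //.
- by rewrite /sign_count -natrX ler_nat; case: pr => //; rewrite expn_gt0.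
- exact: bin_le_expR.
Qed.

Definition code_vec (c : sparse_code) : 'rV[R]_p :=
  \row_j (if j \in code_support c
          then (-1) ^+ (j \in (val c).2) / Num.sqrt k%:R else 0).

Let sq0 : 0 < (Num.sqrt k%:R : R). Proof. by rewrite sqrtr_gt0. Qed.

Lemma code_vec_eq0 c j : (code_vec c 0 j == 0) = (j \notin code_support c).
Proof.
rewrite mxE; case: ifP => _; last by rewrite eqxx.
by rewrite mulf_eq0 signr_eq0 invr_eq0 gt_eqF.
Qed.

Lemma code_vec_lt0 c j : (code_vec c 0 j < 0) = (j \in (val c).2).
Proof.
rewrite mxE /code_support; case: c => -[B S] /= /andP[/= _ SB].
have SB' : S \subset B by apply: (fintype.subset_trans SB); rewrite
    /sign_domain; case: pr; rewrite ?finset.sub0set.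
case: ifP => jB.
  case: (j \in S); first by rewrite expr1 mulN1r oppr_lt0 invr_gt0 sq0.
  by rewrite mul1r ltNge invr_ge0 ltW.
by rewrite ltxx; apply/esym/negbTE; apply: contraFN jB; exact:
    (fintype.subsetP SB').
Qed.

Lemma code_vec_inj : injective code_vec.
Proof.
move=> c c' e; apply: val_inj.
rewrite [val c]surjective_pairing [val c']surjective_pairing; congr (_, _).
  apply/finset.setP => j; apply/negb_inj.
  by rewrite -[LHS]code_vec_eq0 -[RHS]code_vec_eq0 e.
by apply/finset.setP => j; rewrite -!code_vec_lt0 e.
Qed.

Lemma prior_support_code : prior_support R pr p k = range code_vec.
Proof.
apply/seteqP; split => v /=.
  move=> [vals cardv].
  pose B := [set j | v 0 j != 0]%SET; pose S := [set j | v 0 j < 0]%SET.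
  have cBS : is_code pr k (B, S).
    rewrite /is_code /= cardsE cardv eqxx /=; apply/fintype.subsetP => j.
    rewrite inE => vj; rewrite /sign_domain; move: (vals j); rewrite
        /prior_values.
    case: pr; last by move=> _; rewrite inE lt_eqF.
    rewrite !inE => /orP[|] /eqP e; move: vj; rewrite e ?ltxx//.
    by rewrite ltNge divr_ge0// ltW.
  exists (exist _ (B, S) cBS) => //; apply/rowP => j; rewrite mxE
      /code_support/= !inE.
  move: (vals j); rewrite /prior_values.
  have lt1 : (1 / Num.sqrt k%:R < 0 :> R) = false.
    by apply/negbTE; rewrite -leNgt divr_ge0// ltW.
  have ne1 : 1 / Num.sqrt k%:R != 0 :> R by rewrite mul1r invr_eq0 gt_eqF.
  case: pr; rewrite !inE.
    by move=> /orP[|] /eqP ->; rewrite ?eqxx// ne1 lt1 expr0.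
  move=> /or3P[|/eqP ->|/eqP ->]; rewrite ?eqxx// ?ne1 ?lt1 ?expr0//.
  have gt1 : 0 < 1 / Num.sqrt k%:R :> R by rewrite divr_gt0.
  by move=> /eqP ->; rewrite oppr_eq0 ne1 oppr_lt0 gt1 expr1 mulNr.
move=> [c _ <-]; split.
  move=> j; rewrite mxE /code_support /prior_values.
  case: c => -[B S] /= /andP[/= _]; rewrite /sign_domain.
  case: ifP => jB; last by case: pr; rewrite !inE eqxx ?orbT.
  case: pr.
    by rewrite finset.subset0 => /eqP ->; rewrite !inE expr0 eqxx orbT.
  by move=> _; case: (j \in S); rewrite !inE ?expr0 ?expr1 ?mulNr eqxx ?orbT.
rewrite -[RHS](card_code_support c); apply: eq_card => j.
by rewrite !inE -[RHS]negbK -code_vec_eq0.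
Qed.

Lemma card_prior_support : #|` fset_set (prior_support R pr p k)| =
    #|sparse_code|.
Proof.
rewrite prior_support_code.
have -> : fset_set (range code_vec) = [fset code_vec c | c in [set:
    sparse_code]%SET]%fset.
  have fin : finite_set (range code_vec) by apply: finite_image; exact:
      finite_finset.
  apply/fsetP => v; rewrite in_fset_set//; apply/idP/imfsetP => /=.
    by rewrite inE => -[c _ <-]; exists c; rewrite ?inE.
  by move=> [c _ ->]; rewrite inE; exists c.
rewrite card_imfset/=; last exact: code_vec_inj.
by rewrite -cardE cardsT.
Qed.

Lemma code_vec_unit c : \sum_j code_vec c 0 j ^+ 2 = 1.
Proof.
rewrite (bigID (mem (code_support c)))/= [X in _ + X]big1 ?addr0; last first.
  by move=> j; rewrite -code_vec_eq0 => /eqP ->; rewrite expr0n.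
rewrite (eq_bigr (fun=> k%:R^-1)); last first.
  move=> j jc; rewrite mxE jc exprMn exprVn sqr_sqrtr// -exprM mulnC exprM.
  by rewrite sqrrN expr1n expr1n mul1r.
by rewrite sumr_const card_code_support -[LHS]mulr_natr mulVf// gt_eqF.
Qed.

Lemma code_vec_dot u v :
  `|\sum_j code_vec u 0 j * code_vec v 0 j| <=
  #|code_support u :&: code_support v|%:R / k%:R.
Proof.
rewrite (bigID (mem (code_support u :&: code_support v)))/= [X in _ + X]big1
    ?addr0; last first.
  move=> j; rewrite inE negb_and -!code_vec_eq0 => /orP[] /eqP ->.
    by rewrite mul0r.
  by rewrite mulr0.
apply: (le_trans (ler_norm_sum _ _ _)).
rewrite (eq_bigr (fun=> k%:R^-1)); first by rewrite sumr_const -[X in X <=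
    _]mulr_natl.
move=> j; rewrite inE => /andP[ju jv]; rewrite !mxE ju jv !normrM !normrX
    normrN1 !expr1n !mul1r.
by rewrite normfV gtr0_norm// -invfM -expr2 sqr_sqrtr.
Qed.

End overlap_sums.

Lemma tensor_pow_dot (R : realType) (d p : nat) (u v : 'rV[R]_p) :
  \sum_i tensor_pow (d := d) u i * tensor_pow v i = (\sum_j u 0 j * v 0 j) ^+ d.
Proof.
rewrite -[in RHS](card_ord d) -prodr_const bigA_distr_bigA.
by apply: eq_bigr => i _; rewrite /tensor_pow -big_split.
Qed.

(** * Non-asymptotic bounds on the mean square error *)

Section exponents.
Context (R : realType).
Implicit Types beta eps t rho : R.

(** With [rho / (1 + rho) <= t^2 / (1 + t^2) <= t / 2], the gain is
    [(1 - beta^2) t / 2] where [t >= t^2 > eps]; the term in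
    [(1 - beta^2) eps / 16] comes from the width of the typical window. *)
Lemma near_exponent beta eps t rho : 0 <= beta -> beta < 1 -> 0 <= eps ->
  0 <= t <= 1 -> rho <= t ^+ 2 -> eps < rho ->
  beta ^+ 2 * (1 - (1 + Num.max rho 0)^-1) +
    2 * beta * ((1 - beta ^+ 2) * eps / 16) <=
  t / 2 - (1 - beta ^+ 2) * eps / 4.
Proof.
move=> b0 b1 eps0 /andP[t0 t1] rt er.
have rho0 : 0 < rho by exact: le_lt_trans er.
rewrite max_l ?(ltW rho0)//.
have b2 : 0 <= 1 - beta ^+ 2 by nra.
have b2' : 0 <= beta ^+ 2 by exact: sqr_ge0.
have h1 : 1 - (1 + rho)^-1 <= t / 2.
  have -> : 1 - (1 + rho)^-1 = rho / (1 + rho) by field; lra.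
  rewrite ler_pdivrMr; last by lra.
  have := sqr_ge0 (1 - t); nra.
have et : eps <= t by nra.
have h2 : beta ^+ 2 * (1 - (1 + rho)^-1) <= beta ^+ 2 * (t / 2) by exact:
    ler_wpM2l.
have h3 : (1 - beta ^+ 2) * eps <= (1 - beta ^+ 2) * t by exact: ler_wpM2l.
have h4 : beta * ((1 - beta ^+ 2) * eps) <= (1 - beta ^+ 2) * eps.
  by rewrite ler_piMl ?mulr_ge0// ltW.
have h5 : 0 <= (1 - beta ^+ 2) * eps by rewrite mulr_ge0.
nra.
Qed.

(** Here [1 / 2 - 1 / (1 + m) = - (1 - m) / (2 (1 + m))], and
    [(1 - m) / (1 + m)] is at least [1 - t] because [m <= t^2], and at least
    [eps / 2] because [m <= 1 - eps]: the first bound is used with coefficient 1,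
    the second with coefficient [beta^2 - 1]. *)
Lemma far_exponent beta eps t rho : 1 < beta -> 0 <= eps <= 1 ->
  0 <= t <= 1 -> rho <= t ^+ 2 -> rho < 1 - eps ->
  beta ^+ 2 * (1 / 2 - (1 + Num.max rho 0)^-1) +
    beta * ((beta ^+ 2 - 1) * eps / (8 * beta)) <=
  t / 2 - 1 / 2 - (beta ^+ 2 - 1) * eps / 8.
Proof.
move=> b1 /andP[eps0 eps1] /andP[t0 t1] rt er.
set m := Num.max rho 0.
have m0 : 0 <= m by rewrite /m le_max lexx orbT.
have mt : m <= t ^+ 2 by rewrite /m ge_max rt sqr_ge0.
have me : m <= 1 - eps by rewrite /m ge_max (ltW er); lra.
have -> : beta * ((beta ^+ 2 - 1) * eps / (8 * beta)) = (beta ^+ 2 - 1) * eps / 8.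
  by field; lra.
have b2 : 0 < beta ^+ 2 - 1 by nra.
pose a := (1 - m) / (1 + m).
have -> : 1 / 2 - (1 + m)^-1 = - (a / 2) by rewrite /a; field; lra.
have h1 : 1 - t <= a.
  rewrite /a ler_pdivlMr; last by lra.
  have : 0 <= t * (1 - t) ^+ 2 by rewrite mulr_ge0 ?sqr_ge0.
  nra.
have h2 : eps / 2 <= a.
  rewrite /a ler_pdivlMr; last by lra.
  nra.
have h3 : (beta ^+ 2 - 1) * (eps / 2) <= (beta ^+ 2 - 1) * a by rewrite
    ler_wpM2l// ltW.
nra.
Qed.

End exponents.

Section fixed_dimension.
Context d0 (T : measurableType d0) (R : realType) (P : probability T R).
Context (pr : prior) (d p k : nat).
Context (Z : tindex d p -> {RV P >-> R}).
Hypothesis Zgauss : forall i, standard_gaussian (Z i).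
Hypothesis Zind : mutually_independent P Z.
Hypotheses (d2 : (2 <= d)%N) (k0 : (0 < k)%N) (kp : (k <= p)%N).

Local Notation sparse_code := (sparse_code pr p k).
Local Notation M := (#|sparse_code|%:R : R).
Local Notation noise := ((fun w i => Z i w) : T -> rspace R (tindex d p)).

Definition code_tensor (c : sparse_code) : tindex d p -> R := tensor_pow
    (code_vec R c).

Lemma code_tensor_unit c : \sum_i code_tensor c i ^+ 2 = 1.
Proof.
under eq_bigr do rewrite expr2.
rewrite tensor_pow_dot; under eq_bigr do rewrite -expr2.
by rewrite code_vec_unit// expr1n.
Qed.

(** The fraction [t] of common support; it bounds the overlap even when the
    signs disagree. *)
Definition common (u v : sparse_code) : R :=
  #|code_support u :&: code_support v|%:R / k%:R.

Let kR0 : 0 < (k%:R : R). Proof. by rewrite ltr0n. Qed.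
Let pR0 : 0 < (p%:R : R). Proof. by rewrite ltr0n (leq_trans k0). Qed.

Lemma common01 u v : 0 <= common u v <= 1.
Proof.
rewrite divr_ge0//= ler_pdivrMr// mul1r ler_nat.
rewrite -[leqRHS](card_code_support u).
by apply: subset_leq_card; exact: finset.subsetIl.
Qed.

Lemma overlap_code_le u v : overlap code_tensor u v <= common u v ^+ 2.
Proof.
have /andP[c0 c1] := common01 u v.
rewrite /overlap tensor_pow_dot (le_trans (ler_norm _))// normrX.
apply: (@le_trans _ _ (common u v ^+ d)).
  by rewrite lerXn2r ?nnegrE//; exact: code_vec_dot.
by rewrite ler_wiXn2l.
Qed.

Let q : R := ln (p%:R / k%:R).

Let ratio_gt0 : 0 < (p%:R / k%:R : R). Proof. by rewrite divr_gt0. Qed.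

Let q0 : 0 <= q.
Proof. by rewrite /q ln_ge0// ler_pdivlMr// mul1r ler_nat. Qed.

Let ratioX n : (p%:R / k%:R : R) ^+ n = expR (n%:R * q).
Proof. by rewrite expRM_natl lnK. Qed.

Let L := 2 * k%:R * q.

Let L0 : 0 <= L. Proof. by rewrite !mulr_ge0. Qed.

Let ratio_common u v :
  (p%:R / k%:R : R) ^+ #|code_support u :&: code_support v| = expR (L *
      (common u v / 2)).
Proof.
rewrite ratioX; congr expR; rewrite /L /common; field.
by rewrite gt_eqF.
Qed.

Let M0 : 0 < M. Proof. by rewrite ltr0n card_code_gt0. Qed.

Let sum_cst (x : R) : \sum_(u : sparse_code) x = x * M.
Proof. by rewrite sumr_const [RHS]mulr_natr. Qed.

Let two_le_expR n : (2 : R) ^+ n <= expR n%:R.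
Proof.
rewrite -[n%:R]mulr1 expRM_natl lerXn2r ?nnegrE ?expR_ge0//.
by have := expR_ge1Dx (1 : R); lra.
Qed.

(** The threshold [tau] for [D / M] is [exp (- c L / 2)], half of the gain
    [exp (- c L)] of near_exponent. *)
Lemma mse_lower (beta eps c delta : R) : 0 <= beta -> beta < 1 -> 0 <= eps ->
  c = (1 - beta ^+ 2) * eps / 4 -> delta = (1 - beta ^+ 2) * eps / 16 ->
  ((1 - (eps + 4 * expR (- (delta ^+ 2 * k%:R * q)) + expR (- (c * k%:R * q)) +
     expR (k%:R - c * k%:R * q)))%R%:E <=
  \int[P]_w (mse_density code_tensor (beta * Num.sqrt L) (noise w))%:E)%E.
Proof.
move=> b0 b1 eps0 cE deltaE.
have s0 : 0 <= beta * Num.sqrt L by rewrite mulr_ge0 ?sqrtr_ge0.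
have b21 : 0 <= 1 - beta ^+ 2 by nra.
have delta0 : 0 <= delta by rewrite deltaE !mulr_ge0.
have r0 : 0 <= delta * Num.sqrt L by rewrite mulr_ge0 ?sqrtr_ge0.
have tau0 : 0 < expR (- (c * k%:R * q)) by exact: expR_gt0.
have := mse_density_near Zgauss Zind code_tensor_unit (card_code_gt0 pr kp)
    s0 r0 eps0 tau0.
apply: le_trans; rewrite lee_fin lerD2l lerN2.
apply: lerD; last first.
  apply: (@le_trans _ _ (M^-1 / M / expR (- (c * k%:R * q)) *
     \sum_(u : sparse_code) 2 ^+ k * M * expR (- (c * L)))).
    rewrite ler_wpM2l ?mulr_ge0 ?invr_ge0 ?expR_ge0 ?(ltW M0)//.
    apply: ler_sum => u _.
    apply: (@sum_code_le _ _ _ R k0 kp u) => [|v epsv]; first exact: expR_ge0.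
    rewrite ratio_common -expRD ler_expR.
    have := near_exponent b0 b1 eps0 (common01 u v) (overlap_code_le u v) epsv.
    rewrite -cE -deltaE => /(ler_wpM2l L0) h.
    rewrite [leLHS](_ : _ = L * (beta ^+ 2 * (1 - shrinkage code_tensor u v)
        + 2 * beta * delta)).
      apply: (le_trans h); rewrite le_eqVlt; apply/orP; left; apply/eqP; by ring.
    rewrite exprMn sqr_sqrtr//.
    rewrite (_ : 2 * (beta * Num.sqrt L) * (delta * Num.sqrt L) =
      2 * beta * delta * Num.sqrt L ^+ 2); last by ring.
    rewrite sqr_sqrtr//; ring.
  rewrite sum_cst.
  have cancelM (a e e' : R) : 0 < e' ->
      M^-1 / M / e' * (a * M * e * M) = a * (e / e').
    by move=> e'0; field; rewrite !gt_eqF.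
  rewrite cancelM ?expR_gt0//.
  rewrite -expRN -expRD [expR (k%:R - _)]expRD.
  apply: ler_pM; rewrite ?exprn_ge0 ?expR_ge0//.
  rewrite ler_expR /L; nra.
rewrite lerD2r lerD2l ler_wpM2l// ler_expR lerN2 exprMn sqr_sqrtr// /L.
rewrite le_eqVlt; apply/orP; left; apply/eqP; by field.
Qed.

(** The gain [exp (- c L)] must beat [2 ^ k] from the traces of the supports
    and [M exp (- L / 2) <= (2 e) ^ k]; bounding 2 by e gives [exp (3 k)]. *)
Lemma mse_upper (beta eps c delta : R) : 1 < beta -> 0 <= eps <= 1 ->
  c = (beta ^+ 2 - 1) * eps / 8 -> delta = (beta ^+ 2 - 1) * eps / (8 * beta) ->
  (\int[P]_w (mse_density code_tensor (beta * Num.sqrt L) (noise w))%:E <=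
  (eps + 8 * expR (- (delta ^+ 2 * k%:R * q)) +
     2 * expR (3 * k%:R - 2 * c * k%:R * q))%R%:E)%E.
Proof.
move=> b1 eps01 cE deltaE.
have /andP[eps0 eps1] := eps01.
have beta0 : 0 < beta by lra.
have s0 : 0 <= beta * Num.sqrt L by rewrite mulr_ge0 ?sqrtr_ge0// ltW.
have delta0 : 0 <= delta.
  by rewrite deltaE divr_ge0// ?mulr_ge0//; nra.
have r0 : 0 <= delta * Num.sqrt L by rewrite mulr_ge0 ?sqrtr_ge0.
have := mse_density_far Zgauss Zind code_tensor_unit (card_code_gt0 pr kp) s0
    r0 eps0.
move/le_trans; apply; rewrite lee_fin.
apply: lerD.
  rewrite lerD2l ler_wpM2l// ler_expR lerN2 exprMn sqr_sqrtr// /L.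
  rewrite le_eqVlt; apply/orP; left; apply/eqP; by field.
rewrite ler_wpM2l//.
apply: (@le_trans _ _ (M^-1 * \sum_(u : sparse_code) 2 ^+ k * M * expR (- (L
    / 2 + c * L)))).
  rewrite ler_wpM2l ?invr_ge0 ?(ltW M0)//.
  apply: ler_sum => u _.
  apply: (@sum_code_le _ _ _ R k0 kp u) => [|v epsv]; first exact: expR_ge0.
  rewrite ratio_common -expRD ler_expR.
  have := far_exponent b1 eps01 (common01 u v) (overlap_code_le u v) epsv.
  rewrite -cE -deltaE => /(ler_wpM2l L0) h.
  rewrite [leLHS](_ : _ = L * (beta ^+ 2 * (1 / 2 - shrinkage code_tensor u
      v) + beta * delta)).
    apply: (le_trans h); rewrite le_eqVlt; apply/orP; left; apply/eqP; by field.
  rewrite exprMn sqr_sqrtr//.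
  rewrite (_ : (beta * Num.sqrt L) * (delta * Num.sqrt L) =
    beta * delta * Num.sqrt L ^+ 2); last by ring.
  rewrite sqr_sqrtr//; ring.
rewrite sum_cst.
have cancelM (a e : R) : M^-1 * (a * M * e * M) = a * (M * e).
  by field; rewrite !gt_eqF.
rewrite cancelM.
have hM : M <= 2 ^+ k * expR k%:R * expR (k%:R * q).
  rewrite -ratioX expr_div_n mulrA ler_pdivlMr ?exprn_gt0//.
  exact: card_code_le.
have e2 := two_le_expR k.
apply: (@le_trans _ _ (expR k%:R * ((expR k%:R * expR k%:R * expR (k%:R * q))
    * expR (- (L / 2 + c * L))))).
  have Me0 : 0 <= M * expR (- (L / 2 + c * L)) by rewrite mulr_ge0
      ?expR_ge0// ltW.
  apply: ler_pM => //.
  rewrite ler_wpM2r ?expR_ge0//; apply: (le_trans hM).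
  by rewrite ler_wpM2r ?expR_ge0// ler_wpM2r ?expR_ge0.
rewrite -!expRD ler_expR /L.
rewrite le_eqVlt; apply/orP; left; apply/eqP; by field.
Qed.

End fixed_dimension.

Section one_dimension_mmse.
Context d0 (T : measurableType d0) (R : realType) (P : probability T R).
Context (pr : prior) (d p k : nat) (beta : R).
Context (x : 'I_p -> {RV P >-> R}) (Z : tindex d p -> {RV P >-> R}).
Context (C : tindex d p -> T -> R).
Hypotheses (k0 : (0 < k)%N) (kp : (k <= p)%N).
Hypothesis hx : uniform_on P (prior_support R pr p k) (rvec x).
Hypothesis Zgauss : forall i, standard_gaussian (Z i).
Hypothesis Zind : mutually_independent P Z.
Hypothesis hxZ : independent P (sigma_gen x) (sigma_gen Z).
Hypothesis hC : forall i, is_cond_expectation P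
  (sigma_gen (tensor_pca beta k x Z)) (fun w => tensor_pow (rvec x w) i) (C i).

Let ev (c : sparse_code pr p k) : set T := rvec x @^-1` [set code_vec R c].

Let ev_sigma_gen c : sigma_gen x (ev c).
Proof.
rewrite -measurable_preimage_rspace.
exists [set y | forall j, [set code_vec R c 0 j] (y j)].
  have mset j : measurable [set code_vec R c 0 j] by exact: measurable_set1.
  exact: (measurable_rect mset).
rewrite setTI; apply/seteqP; split => w /=.
  by move=> h; apply/rowP => j; rewrite mxE h.
by rewrite /ev /= => <- j; rewrite mxE.
Qed.

Lemma mmse_mse_density :
  ('E_P[(fun w => enorm (fun i => tensor_pow (rvec x w) i - C i w) ^+ 2)%R] =
  \int[P]_w (mse_density (@code_tensor R pr d p k)
     (beta * Num.sqrt (2 * k%:R * ln (p%:R / k%:R))) (fun i => Z i w))%:E)%E.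
Proof.
rewrite unlock.
have mx j : measurable_fun setT (x j) by exact: measurable_funP.
apply: (@mse_mixture _ _ _ _ _ Z Zgauss Zind _ _ ev).
- by move=> c; exact: code_tensor_unit.
- by move=> c; apply: sigma_gen_measurable (ev_sigma_gen c).
- move=> c c' /eqP cc'; apply/seteqP; split => // w [h1 h2].
  by apply: cc'; apply: (@code_vec_inj pr p k R k0); exact: etrans (esym h1) h2.
- move=> c; rewrite /ev hx (card_prior_support pr p R k0).
  by rewrite mem_set// prior_support_code//; exists c.
- exact: (card_code_gt0 pr kp).
- move=> c B mB; apply: hxZ; first exact: ev_sigma_gen.
  by rewrite -measurable_preimage_rspace; exists B => //; rewrite setTI.
- move=> i; apply: measurable_prod => l _.
  rewrite (_ : (fun w => _) = x (i l)); first exact: mx.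
  by apply/funext => w; rewrite mxE.
- by move=> c w evw i; rewrite evw.
- exact: hC.
Qed.

End one_dimension_mmse.

(** * Passage to the limit *)

Section limits.
Context (R : realType).

Lemma expRN_le (z eta : R) : 0 < eta -> eta^-1 <= z -> expR (- z) <= eta.
Proof.
move=> e0 h; rewrite expRN -[eta]invrK lef_pV2 ?posrE ?expR_gt0 ?invr_gt0//.
by apply: (le_trans h); apply: le_trans (expR_ge1Dx z); rewrite lerDr.
Qed.

Lemma ln_ratio_large (k : nat -> nat) (q0 : R) :
  (forall p, (0 < p)%N -> (1 <= k p <= p)%N) ->
  (fun p => (k p)%:R : R) =o_\oo (fun p => p%:R : R) ->
  \forall p \near \oo, (0 < p)%N /\ q0 <= ln (p%:R / (k p)%:R).
Proof.
move=> hk /eqoP /(_ (expR (- q0)) (expR_gt0 _)) H.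
near=> p.
have p0 : (0 < p)%N by near: p; exists 1%N.
split => //.
have /andP[k1 kp] := hk _ p0.
have : `|(k p)%:R : R| <= expR (- q0) * `|p%:R : R| by near: p; exact: H.
rewrite !ger0_norm// => h.
have kR : 0 < ((k p)%:R : R) by rewrite ltr0n.
have pR : 0 < (p%:R : R) by rewrite ltr0n.
rewrite -ler_expR lnK ?posrE ?divr_gt0// ler_pdivlMr//.
by move: h; rewrite expRN -ler_pdivrMl ?invr_gt0 ?expR_gt0// invrK.
Unshelve. all: by end_near. Qed.

Lemma cvg_fin_num_near (f : nat -> \bar R) (l : R) :
  (forall eps, 0 < eps -> eps <= 1 ->
    \forall p \near \oo, ((l - eps)%:E <= f p <= (l + eps)%:E)%E) ->
  (f p @[p --> \oo] --> l%:E)%E.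
Proof.
move=> H; apply/fine_cvgP; split.
  have := H 1 ltr01 (lexx _); apply: filterS => p /andP[h1 h2].
  by rewrite fin_numE -ltNye -ltey (lt_le_trans _ h1) ?ltNyr// (le_lt_trans
      h2) ?ltry.
apply/cvgrPdist_le => eps e0.
pose e := Num.min eps 1.
have := H e; rewrite /e lt_min e0 ltr01 ge_min lexx orbT => /(_ isT isT).
apply: filterS => p /andP[h1 h2].
have ff : f p \is a fin_num.
  by rewrite fin_numE -ltNye -ltey (lt_le_trans _ h1) ?ltNyr// (le_lt_trans
      h2) ?ltry.
move: h1 h2; rewrite -(fineK ff) !lee_fin => h1 h2.
have ee : Num.min eps 1 <= eps by rewrite ge_min lexx.
rewrite /= ler_norml; apply/andP; split; lra.
Qed.

End limits.

Theorem theorem3 (R : realType) (d : nat) (hd : (2 <= d)%N)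
  (k : nat -> nat) (hk : forall p, (0 < p)%N -> (1 <= k p <= p)%N)
  (hko : (fun p => (k p)%:R : R) =o_\oo (fun p => p%:R : R))
  (pr : prior) (beta : R) (hbeta : 0 <= beta)
  (disp : nat -> measure_display) (T : forall p, measurableType (disp p))
  (P : forall p, probability (T p) R)
  (x : forall p, 'I_p -> {RV (P p) >-> R})
  (Z : forall p, tindex d p -> {RV (P p) >-> R})
  (hx : forall p, (0 < p)%N ->
     uniform_on (P p) (prior_support R pr p (k p)) (rvec (x p)))
  (hZgauss : forall p, (0 < p)%N -> forall i, standard_gaussian (Z p i))
  (hZind : forall p, (0 < p)%N -> mutually_independent (P p) (Z p))
  (hxZ : forall p, (0 < p)%N ->
     independent (P p) (sigma_gen (x p)) (sigma_gen (Z p)))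
  (C : forall p, tindex d p -> T p -> R)
  (hC : forall p, (0 < p)%N -> forall i,
     is_cond_expectation (P p)
       (sigma_gen (tensor_pca beta (k p) (x p) (Z p)))
       (fun w => tensor_pow (rvec (x p) w) i) (C p i)) :
  let mmse p :=
    ('E_(P p)[(fun w =>
      enorm (fun i => tensor_pow (rvec (x p) w) i - C p i w) ^+ 2)%R])%E in
  (beta < 1 -> mmse p @[p --> \oo] --> 1%E) /\
  (1 < beta -> mmse p @[p --> \oo] --> 0%E).
Proof.
move=> mmse.
have mmseE p : (0 < p)%N -> mmse p = (\int[P p]_w
    (mse_density (@code_tensor R pr d p (k p))
     (beta * Num.sqrt (2 * (k p)%:R * ln (p%:R / (k p)%:R))) (fun i => Z p i
         w))%:E)%E.
  move=> p0; have /andP[k1 kp] := hk _ p0.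
  exact: (mmse_mse_density k1 kp (hx _ p0) (hZgauss _ p0) (hZind _ p0) (hxZ _
      p0) (hC _ p0)).
split => b1.
  apply: (@cvg_fin_num_near R mmse 1) => eps eps0 eps1.
  have b21 : 0 < 1 - beta ^+ 2 by nra.
  pose c := (1 - beta ^+ 2) * (eps / 2) / 4.
  pose delta := (1 - beta ^+ 2) * (eps / 2) / 16.
  have c0 : 0 < c by rewrite !mulr_gt0.
  have delta0 : 0 < delta by rewrite !mulr_gt0.
  (* The error is [eps / 2] plus [4 + 1 + 1] times a quantity at most [eta]. *)
  pose eta := eps / 12.
  have eta0 : 0 < eta by rewrite divr_gt0.
  near=> p.
  have [p0 q0] : (0 < p)%N /\
      Num.max (eta^-1 / delta ^+ 2) ((eta^-1 + 1) / c) <= ln (p%:R / (k p)%:R).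
    by near: p; exact: ln_ratio_large.
  have /andP[k1 kp] := hk _ p0.
  rewrite mmseE//.
  have code_unit := @code_tensor_unit R pr d p (k p) k1.
  apply/andP; split; last first.
    apply: (le_trans (mse_density_le1 (hZgauss _ p0) (hZind _ p0) _ code_unit
        (card_code_gt0 pr kp))).
    by rewrite lee_fin lerDl ltW.
  have := @mse_lower _ _ _ _ pr _ _ _ _ (hZgauss _ p0) (hZind _ p0) hd k1 kp beta
    (eps / 2) c delta hbeta b1 _ erefl erefl.
  move=> /(_ _)/(le_trans _); apply; last by lra.
  move: q0; set q := ln _; rewrite ge_max => /andP[].
  rewrite ler_pdivrMr ?exprn_gt0// ler_pdivrMr// => q1 q2.
  have kR : 1 <= ((k p)%:R : R) by rewrite ler1n.
  have ei0 : 0 < eta^-1 by rewrite invr_gt0.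
  have e1 : expR (- (delta ^+ 2 * (k p)%:R * q)) <= eta.
    by apply: expRN_le => //; nra.
  have e2 : expR (- (c * (k p)%:R * q)) <= eta.
    by apply: expRN_le => //; nra.
  have e3 : expR ((k p)%:R - c * (k p)%:R * q) <= eta.
    by rewrite -opprB; apply: expRN_le => //; nra.
  rewrite lee_fin; rewrite /eta in e1 e2 e3; lra.
apply: (@cvg_fin_num_near R mmse 0) => eps eps0 eps1.
have b21 : 0 < beta ^+ 2 - 1 by nra.
pose c := (beta ^+ 2 - 1) * (eps / 2) / 8.
pose delta := (beta ^+ 2 - 1) * (eps / 2) / (8 * beta).
have c0 : 0 < c by rewrite !mulr_gt0.
have delta0 : 0 < delta by rewrite /delta divr_gt0// ?mulr_gt0//; lra.
(* The error is [eps / 2] plus [8 + 2] times a quantity at most [eta]. *)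
pose eta := eps / 20.
have eta0 : 0 < eta by rewrite divr_gt0.
near=> p.
have [p0 q0] : (0 < p)%N /\
    Num.max (eta^-1 / delta ^+ 2) ((eta^-1 + 3) / (2 * c)) <= ln (p%:R / (k
        p)%:R).
  by near: p; exact: ln_ratio_large.
have /andP[k1 kp] := hk _ p0.
rewrite mmseE//.
apply/andP; split.
  apply: (@le_trans _ _ 0%E); first by rewrite lee_fin; lra.
  by apply: integral_ge0 => w _; rewrite lee_fin mse_density_ge0.
have := @mse_upper _ _ _ _ pr _ _ _ _ (hZgauss _ p0) (hZind _ p0) hd k1 kp beta
  (eps / 2) c delta b1 _ erefl erefl.
move=> /(_ _)/le_trans; apply; first by lra.
move: q0; set q := ln _; rewrite ge_max => /andP[].
rewrite ler_pdivrMr ?exprn_gt0// ler_pdivrMr ?mulr_gt0// => q1 q2.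
have kR : 1 <= ((k p)%:R : R) by rewrite ler1n.
have ei0 : 0 < eta^-1 by rewrite invr_gt0.
have e1 : expR (- (delta ^+ 2 * (k p)%:R * q)) <= eta.
  by apply: expRN_le => //; nra.
have e3 : expR (3 * (k p)%:R - 2 * c * (k p)%:R * q) <= eta.
  by rewrite -opprB; apply: expRN_le => //; nra.
rewrite lee_fin; rewrite /eta in e1 e3; lra.
Unshelve. all: by end_near. Qed.
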